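(* Consider the closed-loop inverter model $$\dot\xi=v_{dc}-v_{dc,\mathrm{ref}},$$ $$(C_{dc}+K_d)\dot v_{dc}=-G_{dc}v_{dc}+i_{dc,\mathrm{ref}}-K_p(v_{dc}-v_{dc,\mathrm{ref}})-K_i\xi-\tfrac{\mu}{2}\mathbf{e}_2^\top i_{dq},$$ $$L\,\dot i_{dq}=-(R\boldsymbol{I}+v_{dc}\eta L\boldsymbol{J})i_{dq}+\tfrac{\mu}{2}\mathbf{e}_2v_{dc}-v_{dq},$$ $$C\,\dot v_{dq}=-(G\boldsymbol{I}+v_{dc}\eta C\boldsymbol{J})v_{dq}-s_{l,dq}+i_{dq},$$ with modulation amplitude $\mu=\mu_++\tilde\mu$, where $\mu_+$ is the constant defined in the context and $\tilde\mu$ is given by the PI passivity-based feedback $$\dot{\tilde\nu}=y,\qquad\tilde\mu=-\kappa_p\,y-\kappa_i\,\tilde\nu,\qquad y=\tilde i_q\,v_{dc}^*-i_q^*\,\tilde v_{dc}=i_q\,v_{dc,\mathrm{ref}}-i_q^*\,v_{dc},$$ with $\kappa_p,\kappa_i>0$. Assume that the load disturbance $s_{l,dq}\in\mathbb{R}^2$ is a constant measurable signal and that, for the given reference $r_{\mathrm{ref}}>0$, $$\psi=r_{\mathrm{ref}}^2\,\lVert\mathcal{Z}\mathcal{Y}+\boldsymbol{I}\rVert^2-\lVert\mathcal{Z}s_{l,dq}\rVert^2>0.$$ Further assume that $$\frac{C^2\lVert v_{dq}^*\rVert^2}{4G}+\frac{L^2\lVert i_{dq}^*\rVert^2}{4R}<\frac{G_{dc}}{\eta^2}.$$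 Then the unique equilibrium of the closed loop is characterized by $v_{dc}^*=v_{dc,\mathrm{ref}}$ and $\lVert v_{dq}^*\rVert=r_{\mathrm{ref}}$, and is globally asymptotically stable.
   Context: Here $\boldsymbol{I}$ is the $2\times2$ identity, $\boldsymbol{J}=\begin{bmatrix}0&-1\\1&0\end{bmatrix}$, $\mathbf{e}_2=\begin{bmatrix}0\\1\end{bmatrix}$, $\lVert\cdot\rVert$ is the Euclidean norm for vectors and the induced norm for matrices, $\mathcal{Z}=R\boldsymbol{I}+\omega_0L\boldsymbol{J}$, $\mathcal{Y}=G\boldsymbol{I}+\omega_0C\boldsymbol{J}$, with $\omega_0>0$, $v_{dc,\mathrm{ref}}>0$ and $\eta=\omega_0/v_{dc,\mathrm{ref}}$. The parameters $C_{dc},G_{dc},L,R,C,G,K_p,K_i,K_d,i_{dc,\mathrm{ref}}>0$ are constants. The closed-loop state is $(\xi,v_{dc},i_{dq},v_{dq},\tilde\nu)\in\mathbb{R}\times\mathbb{R}\times\mathbb{R}^2\times\mathbb{R}^2\times\mathbb{R}$. The constant $\mu_+$ is $$\mu_+=\frac b2+\sqrt{\Bigl(\frac b2\Bigr)^2+\frac{4\psi}{v_{dc,\mathrm{ref}}^2}},\qquad b=\frac{4}{v_{dc,\mathrm{ref}}}\,\mathbf{e}_2^\top\mathcal{Z}\,s_{l,dq}.$$ Starred quantities $(\xi^*,v_{dc}^*,i_{dq}^*,v_{dq}^* )$ denote the equilibrium of the inverter model for constant $\mu=\mu_+$ (so $v_{dc}^*=v_{dc,\mathrm{ref}}$), and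 tildes denote errors with respect to it, e.g. $\tilde v_{dc}=v_{dc}-v_{dc}^*$. The subscript $q$ denotes the second component: $i_q=\mathbf{e}_2^\top i_{dq}$, $\tilde i_q=\mathbf{e}_2^\top\tilde i_{dq}$, and $i_q^*=\mathbf{e}_2^\top i_{dq}^*=\mathbf{e}_2^\top(\mathcal{Z}+\mathcal{Y}^{-1})^{-1}\bigl(\tfrac{\mu_+}{2}\mathbf{e}_2v_{dc,\mathrm{ref}}+\mathcal{Y}^{-1}s_{l,dq}\bigr)$. *)

(* Defs.v *)
From HB Require Import structures.
From mathcomp Require Import all_boot all_order all_algebra.
From mathcomp Require Import all_classical all_reals all_analysis.

Set Implicit Arguments.
Unset Strict Implicit.
Unset Printing Implicit Defensive.

Import Order.TTheory GRing.Theory Num.Theory.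
Import numFieldNormedType.Exports.

Local Open Scope classical_set_scope.
Local Open Scope ring_scope.

(* The library norm on matrices is the sup norm of the entries, so the
   Euclidean norm and the matrix norm it induces are defined here. *)
Definition enorm (R : realType) n (v : 'cV[R]_n) : R :=
  Num.sqrt (\sum_i v i ord0 ^+ 2).

Definition opnorm (R : realType) m n (A : 'M[R]_(m, n)) : R :=
  sup [set enorm (A *m v) | v in [set v : 'cV[R]_n | enorm v = 1]].

(* A differential system on E in descriptor form: [sys x dx] holds when the
   velocity dx is admissible at x.  This allows equations such as
   L * i' = ... to be kept with their leading coefficient. *)
Section Stability.
Variables (R : realType) (E : normedModType R) (sys : E -> E -> Prop).

Definition equilibrium (xe : E) : Prop := sys xe 0.

(* Solutions on [0, +oo[: differentiable on ]0, +oo[ and right-continuous at 0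
   (values at negative times are irrelevant). *)
Definition solution (x : R -> E) : Prop :=
  x t @[t --> 0^'+] --> x 0 /\
  forall t : R, 0 < t -> derivable x t 1 /\ sys (x t) ('D_1 x t).

Definition forward_complete : Prop :=
  forall x0 : E, exists2 x : R -> E, solution x & x 0 = x0.

Definition stable (xe : E) : Prop :=
  forall eps : R, 0 < eps -> exists2 delta : R, 0 < delta &
    forall x : R -> E, solution x -> `|x 0 - xe| < delta ->
      forall t : R, 0 <= t -> `|x t - xe| < eps.

Definition globally_attractive (xe : E) : Prop :=
  forall x : R -> E, solution x -> x t @[t --> +oo] --> xe.

(* Forward completeness is part of the definition: the region of attraction
   consists of initial states whose solution exists for all t >= 0. *)
Definition globally_asymptotically_stable (xe : E) : Prop :=
  [/\ forward_complete, stable xe & globally_attractive xe].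

End Stability.

Record params (R : realType) := Params {
  Cdc : R; Gdc : R;
  Lf : R; Rf : R; Cf : R; Gf : R;     (* AC filter: L, R, C, G *)
  Kp : R; Ki : R; Kd : R; idc_ref : R;
  omega0 : R; vdc_ref : R; r_ref : R;
  kappa_p : R; kappa_i : R;
  sl : 'cV[R]_2                       (* load disturbance s_{l,dq} *)
}.

Section Inverter.
Variables (R : realType) (p : params R).

Definition J2 : 'M[R]_2 := delta_mx 1 0 - delta_mx 0 1.
Definition e2 : 'cV[R]_2 := delta_mx 1 0.
Definition qcomp (v : 'cV[R]_2) : R := v 1 0.

Definition eta_ref : R := omega0 p / vdc_ref p.
Definition Zmx : 'M[R]_2 := (Rf p)%:M + (omega0 p * Lf p) *: J2.
Definition Ymx : 'M[R]_2 := (Gf p)%:M + (omega0 p * Cf p) *: J2.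

Definition psi : R :=
  r_ref p ^+ 2 * opnorm (Zmx *m Ymx + 1%:M) ^+ 2 - enorm (Zmx *m sl p) ^+ 2.
Definition b_coef : R := 4 / vdc_ref p * qcomp (Zmx *m sl p).
Definition mu_plus : R :=
  b_coef / 2 + Num.sqrt ((b_coef / 2) ^+ 2 + 4 * psi / vdc_ref p ^+ 2).

(* (xi, vdc, idq, vdq) *)
Definition inv_state := (R^o * R^o * 'cV[R]_2 * 'cV[R]_2)%type.

Definition inverter (mu : R) (x dx : inv_state) : Prop :=
  let: (xi, vdc, idq, vdq) := x in
  let: (dxi, dvdc, didq, dvdq) := dx in
  [/\ dxi = vdc - vdc_ref p,
      (Cdc p + Kd p) * dvdc =
        - (Gdc p * vdc) + idc_ref p - Kp p * (vdc - vdc_ref p) - Ki p * xi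
        - mu / 2 * qcomp idq,
      Lf p *: didq =
        - (((Rf p)%:M + (vdc * eta_ref * Lf p) *: J2) *m idq)
        + (mu / 2 * vdc) *: e2 - vdq
    & Cf p *: dvdq =
        - (((Gf p)%:M + (vdc * eta_ref * Cf p) *: J2) *m vdq) - sl p + idq].

(* The starred quantities: the equilibrium for the constant mu = mu_plus.
   [get] is definite description, with an arbitrary value should no
   equilibrium exist. *)
Definition star : inv_state := get (equilibrium (inverter mu_plus)).
Definition vdc_star : R := star.1.1.2.
Definition idq_star : 'cV[R]_2 := star.1.2.
Definition vdq_star : 'cV[R]_2 := star.2.

(* (inverter state, nu_tilde) *)
Definition cl_state := (inv_state * R^o)%type.

Definition y_out (x : inv_state) : R :=
  let: (_, vdc, idq, _) := x in
  (qcomp idq - qcomp idq_star) * vdc_star - qcomp idq_star * (vdc - vdc_star).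

Definition closed_loop (z dz : cl_state) : Prop :=
  let: (x, nu) := z in
  let: (dx, dnu) := dz in
  let mu_tilde := - (kappa_p p * y_out x) - kappa_i p * nu in
  inverter (mu_plus + mu_tilde) x dx /\ dnu = y_out x.

End Inverter.

(* Main.v *)
Require Import Defs.
From HB Require Import structures.
From mathcomp Require Import all_boot all_order all_algebra.
From mathcomp Require Import all_classical all_reals all_analysis.
From mathcomp Require Import ring lra.
Import Order.TTheory GRing.Theory Num.Theory.
Import numFieldNormedType.Exports.
Local Open Scope classical_set_scope.
Local Open Scope ring_scope.

(** In error coordinates the closed loop is a polynomial system whose storage
    function [energy] (the quadratic energy of the errors, plus kappa_i nu^2 / 4)
    decreases.  Its derivative is computed in [denergy_error_field]: the switching terms cancel because [y_out] is the
    passive output paired with the modulation, and the feedback contributes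
    -kappa_p y^2 / 2.  What remains are the resistive losses and two terms, linear
    in the starred currents and voltages, which come from the frequency of the
    rotating frame varying with the dc voltage.  The stability hypothesis is what
    lets the losses absorb these terms ([dissipation]), so the energy controls
    all the coordinates and strictly dissipates all of them but two: the
    integrator states xi and nu.

    Instead of an invariance principle, the two missing coordinates are damped by
    small cross terms.  The current equation makes the derivative of L nu i_q
    contain - kappa_i v_ref nu^2 / 2, and the dc equation makes the derivative of
    (C_dc + K_d) xi v contain - K_i xi^2; everything else in these derivatives is
    dominated on a bounded set ([dcurrent_cross_le], [dvoltage_cross_le]),
    provided the second weight is small compared with the first
    ([cross_weights]).  The sum is a strict Lyapunov function on each sublevel set
    of the energy ([strict_lyapunov]), hence every solution converges; stability
    follows from the energy alone.

    Forward completeness needs an existence theorem.  Clamping the coordinates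
    makes the field globally bounded and Lipschitz, so Picard iteration yields a
    global solution ([picard_lindelof]), and the energy keeps this solution in
    the region where clamping does nothing ([barrier]).

    The equilibrium is explicit because the matrices Z, Y and Z Y + I are all
    combinations of I and J, that is, multiplications by complex numbers.  Such a
    matrix scales the Euclidean norm by a constant, which is its induced norm, so
    the equation satisfied by mu_+ says exactly that the voltage has norm r_ref. *)

(** * Differential inequalities on the half-line *)

Lemma lipschitz_continuous (R : realType) (f : R -> R) (k : R) :
  (forall s t, `|f s - f t| <= k * `|s - t|) -> continuous f.
Proof.
move=> flip t; apply/cvgrPdist_lt => e e0.
have k1 : 0 < `|k| + 1 by rewrite ltr_wpDl.
near=> s.
apply: (le_lt_trans (flip t s)).
apply: (@le_lt_trans _ _ ((`|k| + 1) * `|t - s|)).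
  apply: ler_wpM2r => //; rewrite (le_trans (ler_norm k))// lerDl//.
rewrite mulrC -ltr_pdivlMr//; near: s.
by apply: cvgr_dist_lt => //; exact: divr_gt0.
Unshelve. all: by end_near. Qed.

Lemma nonincreasing_of_derive_le0 (R : realType) (f df : R -> R) :
  f t @[t --> 0^'+] --> f 0 ->
  (forall t : R, 0 < t -> is_derive t 1 f (df t)) ->
  (forall t : R, 0 < t -> df t <= 0) ->
  forall s t : R, 0 <= s -> s <= t -> f t <= f s.
Proof.
move=> f0 fd df0 s t s0 st.
have pos (x : R) : x \in `]0, +oo[ -> 0 < x by rewrite in_itv/= andbT.
apply: (@ler0_derive1_nincry R f 0) => //.
- by move=> x /pos x0; case: (fd x x0).
- by move=> x /pos x0; rewrite derive1E (@derive_val _ _ _ _ _ _ _ (fd x x0)) df0.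
- apply/continuous_within_itvcyP; split => //.
  move=> x /pos x0; apply/differentiable_continuous/derivable1_diffP.
  by case: (fd x x0).
Qed.

Lemma is_derive_cvg_right (R : realType) (f : R -> R) (t df : R) :
  is_derive t 1 f df -> f s @[s --> t^'+] --> f t.
Proof.
move=> [fd _]; apply: cvg_at_right_filter.
by apply/differentiable_continuous/derivable1_diffP.
Qed.

Lemma mean_value_inequality (R : realType) (f df w dw : R -> R) :
  (forall t : R, 0 <= t -> is_derive t 1 f (df t)) ->
  (forall t : R, 0 <= t -> is_derive t 1 w (dw t)) ->
  (forall t : R, 0 <= t -> `|df t| <= dw t) ->
  forall s t : R, 0 <= s -> s <= t -> `|f t - f s| <= w t - w s.
Proof.
move=> fD wD dfw s t s0 st.
have fwD (t' : R) : 0 <= t' -> is_derive t' 1 (f - w) (df t' - dw t').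
  by move=> t'0; exact: is_deriveB (fD _ t'0) (wD _ t'0).
have fwN (t' : R) : 0 <= t' -> is_derive t' 1 (- f - w) (- df t' - dw t').
  by move=> t'0; exact: is_deriveB (is_deriveN (fD _ t'0)) (wD _ t'0).
have dfw' (t' : R) : 0 < t' -> - dw t' <= df t' <= dw t'.
  by move=> /ltW t'0; rewrite -ler_norml; exact: dfw.
have up : (f - w) t <= (f - w) s.
  apply: (@nonincreasing_of_derive_le0 _ _ (fun t' => df t' - dw t')) => //.
  - exact: is_derive_cvg_right (fwD 0 _).
  - by move=> t' /ltW; exact: fwD.
  - by move=> t' /dfw' /andP[_]; rewrite subr_le0.
have dn : (- f - w) t <= (- f - w) s.
  apply: (@nonincreasing_of_derive_le0 _ _ (fun t' => - df t' - dw t')) => //.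
  - exact: is_derive_cvg_right (fwN 0 _).
  - by move=> t' /ltW; exact: fwN.
  - by move=> t' /dfw' /andP[+ _]; lra.
have upE (t' : R) : (f - w) t' = f t' - w t' by [].
have dnE (t' : R) : (- f - w) t' = - f t' - w t' by [].
rewrite !upE in up; rewrite !dnE in dn.
rewrite ler_norml; apply/andP; split; lra.
Qed.

(** Starting the integral at -1 rather than at 0 makes the primitive
    differentiable on both sides of 0. *)
Lemma primitive_of_continuous (R : realType) (h : R -> R) :
  continuous h ->
  exists2 F : R -> R, F 0 = 0 & forall t : R, 0 <= t -> is_derive t 1 F (h t).
Proof.
move=> hc.
pose G (x : R) := (\int[lebesgue_measure]_(t in `[(-1 : R), x]) h t)%R.
exists (fun x => G x - G 0); first by rewrite subrr.
move=> t t0.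
have [Gd Gt] : derivable G t 1 /\ derive1 G t = h t.
  apply: (@continuous_FTC1_closed _ _ _ _ (t + 1)).
  - by rewrite ltrDl.
  - apply: continuous_compact_integrable; first exact: segment_compact.
    by apply: continuous_subspaceT => x; exact: hc.
  - by apply: lt_le_trans t0; rewrite ltrN10.
  - exact: hc.
clearbody G.
have GD : is_derive t 1 G (h t) by apply: (DeriveDef Gd); rewrite -derive1E.
by apply: is_derive_eq; rewrite subr0.
Qed.

(** * Existence of solutions *)

(** The sequences u_n - C / 2^n and u_n + C / 2^n are monotone and enclose the
    limit, which gives the rate of convergence at once. *)
Lemma geometric_limit (R : realType) (u : nat -> R) (C : R) :
  (forall n, `|u n.+1 - u n| <= C / 2 ^+ n.+1) ->
  exists l, forall n, `|u n - l| <= C / 2 ^+ n.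
Proof.
move=> hu.
have pow n : C / 2 ^+ n = 2 * (C / 2 ^+ n.+1).
  have : (2 : R) ^+ n != 0 by rewrite expf_neq0.
  by rewrite exprS => h2; field.
pose v n := u n - C / 2 ^+ n; pose w n := u n + C / 2 ^+ n.
have vS n : v n <= v n.+1.
  have := hu n; rewrite ler_norml => /andP[h _].
  rewrite /v (pow n); lra.
have wS n : w n.+1 <= w n.
  have := hu n; rewrite ler_norml => /andP[_ h].
  rewrite /w (pow n); lra.
have vm : {homo v : m n / (m <= n)%N >-> m <= n}.
  by apply: homo_leq => //; exact: le_trans.
have wm : {homo w : m n / (m <= n)%N >-> n <= m}.
  by apply: homo_leq => // a b c ab bc; exact: le_trans bc ab.
have C0 n : 0 <= C / 2 ^+ n.
  by rewrite pow mulr_ge0// (le_trans _ (hu n)).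
have vw m n : v m <= w n.
  have [mn|nm] := leqP m n.
    apply: le_trans (vm _ _ mn) _; have := C0 n; rewrite /v /w; lra.
  apply: le_trans (wm _ _ (ltnW nm)); have := C0 m; rewrite /v /w; lra.
have hs : has_sup (range v).
  split; first by exists (v 0%N), 0%N.
  by exists (w 0%N) => _ [n _ <-].
exists (sup (range v)) => n.
have h1 : v n <= sup (range v).
  by apply: sup_upper_bound => //; exists n.
have h2 : sup (range v) <= w n.
  by apply: ge_sup; [exact: hs.1|move=> _ [m _ <-]].
by rewrite ler_norml; rewrite /v /w in h1 h2; apply/andP; split; lra.
Qed.

Lemma le_of_geometric (R : realType) (a b C : R) :
  (forall n, a <= b + C / 2 ^+ n) -> a <= b.
Proof.
move=> h; apply/ler_addgt0Pr => e e0.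
have [n hn] : exists n : nat, `|C| / e < n%:R.
  exists (Num.bound (`|C| / e)); apply: archi_boundP.
    by rewrite divr_ge0// ltW.
apply: le_trans (h n) _; rewrite lerD2l.
apply: le_trans (ler_norm _) _; rewrite normrM normfV [`|2 ^+ n|]ger0_norm ?exprn_ge0//.
have n2 : (n%:R : R) < 2 ^+ n by rewrite -natrX ltr_nat ltn_expl.
rewrite ler_pdivrMr ?exprn_gt0// mulrC -ler_pdivrMr//.
exact/ltW/(lt_trans hn).
Qed.

Section Picard.
Context {R : realType} {I : Type}.
Implicit Types (c d : R -> I -> R) (t : R).

(** Picard iteration, with distances between curves measured against the weight
    exp (2 K t): integrating a field of Lipschitz constant K then halves the
    distance, on the whole half-line and not just for short times.  The iterates
    are B-Lipschitz in time, and so is their limit, which makes it continuous.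
    The estimates are uniform in the coordinate, so the index type is arbitrary. *)
Lemma picard_lindelof (g : (I -> R) -> I -> R) (B K : R) (x0 : I -> R) :
  0 < K ->
  (forall u i, `|g u i| <= B) ->
  (forall u v e, (forall j, `|u j - v j| <= e) ->
     forall i, `|g u i - g v i| <= K * e) ->
  exists x : R -> I -> R, x 0 = x0 /\
    forall t i, 0 <= t -> is_derive t 1 (x^~ i) (g (x t) i).
Proof.
move=> K0 gB glip.
pose lips c := forall (s t : R) i, 0 <= s -> 0 <= t -> `|c s i - c t i| <= B * `|s - t|.
have [prim primP] : {prim : (R -> R) -> R -> R & forall h, continuous h ->
    prim h 0 = 0 /\ forall t, 0 <= t -> is_derive t 1 (prim h) (h t)}.
  apply: (@choice _ _ (fun h F => continuous h ->
    F 0 = 0 /\ forall t, 0 <= t -> is_derive t 1 F (h t))) => h.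
  have [hc|nhc] := pselect (continuous h); last by exists h.
  by have [F F0 FD] := @primitive_of_continuous _ _ hc; exists F.
(* The absolute value extends the integrand continuously to negative times. *)
pose step c t i := x0 i + prim (fun s : R => g (c `|s|) i) t.
have gc c i : lips c -> continuous (fun s : R => g (c `|s|) i).
  move=> cl; apply: (@lipschitz_continuous _ (fun s : R => g (c `|s|) i) (K * B)) => s t.
  rewrite -mulrA; apply: glip => j; apply: le_trans (cl _ _ _ _ _) _ => //.
  apply: ler_wpM2l; last exact: ler_dist_dist.
  exact: le_trans (normr_ge0 _) (gB x0 i).
have step0 c i : lips c -> step c 0 i = x0 i.
  by move=> cl; rewrite /step (primP _ (gc c i cl)).1 addr0.
have stepD c t i : lips c -> 0 <= t -> is_derive t 1 ((step c)^~ i) (g (c t) i).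
  move=> cl t0; have PD := (primP _ (gc c i cl)).2 _ t0.
  by apply: is_derive_eq; rewrite add0r mul1r ger0_norm.
have step_lips c : lips c -> lips (step c).
  move=> cl; have key s t i : 0 <= s -> s <= t -> `|step c s i - step c t i| <= B * `|s - t|.
    move=> s0 st.
    rewrite distrC [`|s - t|]distrC [`|t - s|]ger0_norm ?subr_ge0// mulrBr.
    apply: (@mean_value_inequality _ (fun t' => step c t' i) (fun t' => g (c t') i)
              (fun t' => B * t') (fun=> B)) => // t' t'0; first exact: stepD.
    by apply: is_derive_eq; rewrite /GRing.scale /=; ring.
  move=> s t i s0 t0; have [st|/ltW ts] := leP s t; first exact: key.
  by rewrite distrC [`|s - t|]distrC; exact: key.
pose E t : R := expR (2 * K * t).
have contr c d A : lips c -> lips d ->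
    (forall t i, 0 <= t -> `|c t i - d t i| <= A * E t) ->
    forall t i, 0 <= t -> `|step c t i - step d t i| <= A / 2 * E t.
  move=> cl dl cd t i t0.
  have A0 : 0 <= A.
    have := le_trans (normr_ge0 _) (cd 0 i (lexx _)).
    by rewrite /E mulr0 expR0 mulr1.
  have ED t' : is_derive t' 1 E (2 * K * E t').
    by apply: is_derive_eq; rewrite /E /GRing.scale /=; ring.
  have := @mean_value_inequality _ (fun t' => step c t' i - step d t' i)
    (fun t' => g (c t') i - g (d t') i) (fun t' => A / 2 * E t')
    (fun t' => A / 2 * (2 * K * E t')) _ _ _ 0 t (lexx _) t0.
  rewrite !step0// subrr subr0 => h.
  apply: (@le_trans _ _ (A / 2 * E t - A / 2 * E 0)); last first.
    by rewrite lerBlDr lerDl mulr_ge0 ?divr_ge0// /E expR_ge0.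
  apply: h => t' t'0.
  - exact: is_deriveB (stepD c t' i cl t'0) (stepD d t' i dl t'0).
  - have -> : A / 2 * (2 * K * E t') = K * (A * E t') by field.
    by apply: glip => j; exact: cd.
pose x n := iter n step (fun _ => x0).
have x_lips n : lips (x n).
  elim: n => [s t i _ _|n IH]; last exact: step_lips.
  by rewrite subrr normr0 mulr_ge0// (le_trans _ (gB x0 i)).
(* From B t = (A / 2) (2 K t) <= (A / 2) exp (2 K t). *)
pose A := B / K.
have succ n t i : 0 <= t -> `|x n.+1 t i - x n t i| <= A / 2 ^+ n.+1 * E t.
  elim: n t i => [|n IH] t i t0; last first.
    by rewrite exprSr invfM mulrA; apply: (contr (x n.+1) (x n)).
  have := step_lips _ (x_lips 0%N) t 0 i t0 (lexx _).
  rewrite [x 1%N]/(step _) /= step0; last exact: (x_lips 0%N).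
  rewrite subr0 [X in B * X]ger0_norm// => /le_trans; apply.
  have B0 : 0 <= B by apply: le_trans (gB x0 i).
  have -> : B * t = A / 2 * (2 * K * t).
    by rewrite /A; field; rewrite gt_eqF.
  rewrite expr1 ler_wpM2l ?divr_ge0// ?(ltW K0)//.
  apply: le_trans (expR_ge1Dx _); lra.
have [y yP] : {y : R * I -> R & forall ti, 0 <= ti.1 ->
    forall n, `|x n ti.1 ti.2 - y ti| <= A * E ti.1 / 2 ^+ n}.
  apply: (@choice _ _ (fun ti l => 0 <= ti.1 ->
    forall n, `|x n ti.1 ti.2 - l| <= A * E ti.1 / 2 ^+ n)) => -[t i] /=.
  have [t0|t0] := pselect (0 <= t); last by exists 0.
  have [n|l hl] := @geometric_limit _ (fun n => x n t i) (A * E t).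
    by rewrite mulrAC; exact: succ.
  by exists l.
pose z t i := y (t, i).
have zP t i n : 0 <= t -> `|x n t i - z t i| <= A / 2 ^+ n * E t.
  by move=> t0; rewrite mulrAC; exact: (yP (t, i)).
have z_lips : lips z.
  move=> s t i s0 t0.
  apply: (@le_of_geometric _ _ _ (A * E s + A * E t)) => n.
  have -> : z s i - z t i =
     - (x n s i - z s i) + (x n s i - x n t i) + (x n t i - z t i) by ring.
  apply: le_trans (ler_normD _ _) _.
  apply: (@le_trans _ _ (A / 2 ^+ n * E s + B * `|s - t| + A / 2 ^+ n * E t)).
    apply: lerD; last exact: zP.
    by apply: le_trans (ler_normD _ _) _; rewrite normrN lerD//; [exact: zP|exact: x_lips].
  by rewrite le_eqVlt; apply/orP; left; apply/eqP; ring.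
have fix_z t i : 0 <= t -> step z t i = z t i.
  move=> t0; apply/eqP; rewrite -subr_eq0 -normr_le0.
  apply: (@le_of_geometric _ _ _ (A * E t)) => n; rewrite add0r.
  have -> : step z t i - z t i =
     - (x n.+1 t i - step z t i) + (x n.+1 t i - z t i) by ring.
  apply: le_trans (ler_normD _ _) _; rewrite normrN.
  have h1 : `|x n.+1 t i - step z t i| <= A / 2 ^+ n / 2 * E t.
    by apply: contr => // t' j t'0; exact: zP.
  have h2 := zP t i n.+1 t0.
  apply: le_trans (lerD h1 h2) _.
  have : (2 : R) ^+ n != 0 by rewrite expf_neq0.
  by move=> p2; rewrite exprS le_eqVlt; apply/orP; left; apply/eqP; field.
exists (step z); split; first by apply/funext => i; exact: step0.
move=> t i t0; have -> : step z t = z t by apply/funext => j; exact: fix_z.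
exact: stepD.
Qed.

End Picard.

(** * Barriers and decay *)

(** Consider the last time at which f <= a: just after it f is still below b,
    hence nonincreasing, so f stays below a a little longer. *)
Lemma barrier (R : realType) (f df : R -> R) (a b : R) :
  a < b ->
  (forall t : R, 0 <= t -> is_derive t 1 f (df t)) ->
  (forall t : R, 0 <= t -> f t <= b -> df t <= 0) ->
  f 0 <= a -> forall t : R, 0 <= t -> f t <= a.
Proof.
move=> ab fD df0 f0 t t0; rewrite leNgt; apply/negP => ft.
pose S := [set s : R | (0 <= s) && (s <= t) && (f s <= a)].
have S0 : S 0 by rewrite /S /= lexx t0 f0.
have Ssup : has_sup S.
  by split; [exists 0|exists t => s /= /andP[/andP[]]].
pose m := sup S.
have m0 : 0 <= m by exact: sup_upper_bound.
have mt : m <= t by apply: ge_sup; [exists 0|move=> s /= /andP[/andP[]]].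
have fc : f s @[s --> m] --> f m.
  apply/differentiable_continuous/derivable1_diffP.
  by case: (fD m m0).
have fm : f m <= a.
  rewrite leNgt; apply/negP => afm.
  have /nbhs_ballP[e /= e0 he] : \forall s \near m, a < f s.
    by apply: (cvgr_gt _ fc).
  have [s Ss ms] := sup_adherent e0 Ssup.
  have sm : s <= m by exact: sup_upper_bound.
  move: Ss => /= /andP[_]; apply/negP; rewrite -ltNge; apply: he.
  rewrite /ball /= ger0_norm ?subr_ge0// -/m in ms *; lra.
have mt' : m < t by rewrite lt_neqAle mt andbT; apply/eqP => mE; rewrite mE leNgt ft in fm.
have /nbhs_ballP[e /= e0 he] : \forall s \near m, f s < b.
  by apply: (cvgr_lt _ fc); exact: le_lt_trans fm ab.
pose s := Num.min t (m + e / 2).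
have ms : m < s by rewrite lt_min mt' ltrDl divr_gt0.
have st : s <= t by rewrite ge_min lexx.
have se : s <= m + e / 2 by rewrite ge_min lexx orbT.
have [c cms fE] : exists2 c, c \in `]m, s[%R & f s - f m = df c * (s - m).
  apply: MVT => //.
    by move=> x; rewrite in_itv /= => /andP[mx _]; apply: fD; lra.
  apply: derivable_within_continuous => x; rewrite in_itv /= => /andP[mx _].
  by case: (fD x (le_trans m0 mx)).
move: cms; rewrite in_itv /= => /andP[mc cs].
have dfc : df c <= 0.
  apply: df0; first exact: le_trans (ltW mc).
  apply/ltW/he; rewrite /ball /= distrC gtr0_norm ?subr_gt0//; lra.
have : s <= m.
  apply: sup_upper_bound => //; rewrite /S /= st (le_trans m0 (ltW ms)) /=.
  have : df c * (s - m) <= 0 by rewrite mulr_le0_ge0// subr_ge0 ltW.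
  rewrite -fE; lra.
by rewrite leNgt ms.
Qed.

(** The function (1 + k t) f(t) is nonincreasing; this bound by f(0) / (1 + k t)
    suffices and spares the exponential. *)
Lemma decay_to_zero (R : realType) (f df : R -> R) (k : R) :
  0 < k -> f t @[t --> 0^'+] --> f 0 ->
  (forall t : R, 0 < t -> is_derive t 1 f (df t)) ->
  (forall t : R, 0 < t -> 0 <= f t /\ df t <= - k * f t) ->
  f t @[t --> +oo] --> 0.
Proof.
move=> k0 f0 fD fdf.
pose w t := (1 + k * t) * f t.
have wle (t : R) : 0 < t -> w t <= w 0.
  move=> t0; pose dw t := k * f t + (1 + k * t) * df t.
  apply: (@nonincreasing_of_derive_le0 _ w dw) (ltW t0) => //.
  - apply: cvgM => //; apply: (@is_derive_cvg_right _ _ _ k).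
    by apply: is_derive_eq; rewrite /GRing.scale /=; ring.
  - move=> s s0; have := fD s s0 => ?; apply: is_derive_eq.
    by rewrite /dw /GRing.scale /=; ring.
  - move=> s s0; have [fs dfs] := fdf s s0.
    have ks : 0 <= k * s by rewrite mulr_ge0 ?ltW.
    apply: (@le_trans _ _ (k * f s + (1 + k * s) * (- k * f s))).
      by rewrite lerD2l ler_wpM2l// addr_ge0.
    have -> : k * f s + (1 + k * s) * (- k * f s) = - (k * s * (k * f s)) by ring.
    by rewrite oppr_le0 mulr_ge0// mulr_ge0// ltW.
apply/cvgrPdist_lt => e e0; near=> t.
have t0 : 0 < t by near: t; exact: nbhs_pinfty_gt.
have [ft _] := fdf t t0.
rewrite sub0r normrN ger0_norm//.
have kt : 0 < 1 + k * t by rewrite addr_gt0// mulr_gt0.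
rewrite -(ltr_pM2l kt); apply: le_lt_trans (wle t t0) _.
rewrite /w mulr0 addr0 mul1r.
have h : f 0 / e / k < t by near: t; apply: nbhs_pinfty_gt; exact: num_real.
rewrite ltr_pdivrMr// ltr_pdivrMr// in h.
by rewrite (lt_trans h)// ltr_pM2r// [t * k]mulrC ltrDr.
Unshelve. all: by end_near. Qed.

Lemma young (R : realType) (a x y s : R) :
  0 < s -> a * x * y <= s / 4 * y ^+ 2 + a ^+ 2 / s * x ^+ 2.
Proof.
move=> s0; rewrite -subr_ge0.
have -> : s / 4 * y ^+ 2 + a ^+ 2 / s * x ^+ 2 - a * x * y = (s * y / 2 - a * x) ^+ 2 / s.
  by field; rewrite gt_eqF.
by rewrite divr_ge0 ?sqr_ge0// ltW.
Qed.

(** Completing squares.  The left-hand side is the power injected by a rotating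
    frame whose speed varies: z is the dc voltage error, (x, y) an error vector and
    (a, b) the equilibrium vector; the constant k^2 (a^2 + b^2) / (4 r) is the one
    of the stability condition. *)
Lemma gyroscopic_young (R : realType) (k e r a b x y z : R) : 0 < r ->
  e * k * z * (x * b - y * a) <=
    r * (x ^+ 2 + y ^+ 2) + e ^+ 2 * (k ^+ 2 * (a ^+ 2 + b ^+ 2) / (4 * r)) * z ^+ 2.
Proof.
move=> r0; rewrite -subr_ge0.
have -> : r * (x ^+ 2 + y ^+ 2) + e ^+ 2 * (k ^+ 2 * (a ^+ 2 + b ^+ 2) / (4 * r)) * z ^+ 2
  - e * k * z * (x * b - y * a) =
  ((2 * r * x - e * k * z * b) ^+ 2 + (2 * r * y + e * k * z * a) ^+ 2) / (4 * r).
  by field; rewrite gt_eqF.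
by rewrite divr_ge0 ?addr_ge0 ?sqr_ge0// mulr_ge0// ltW.
Qed.

(** Here d stands for the coordinates dissipated by the energy, n and x for the two
    integrator states.  The only coupling between n and x is the term r n x, which
    comes with the weight e2: taking e2 a small multiple of e1 lets the damping of n
    dominate it.  The bound e0 keeps the weights small enough for the cross terms
    to be dominated by the energy itself. *)
Lemma cross_weights (R : realType) (c p q A r e0 : R) :
  0 < c -> 0 < p -> 0 < q -> 0 < e0 -> 0 <= A -> 0 <= r ->
  exists e1 e2 k, [/\ 0 < e1 <= e0, 0 < e2 <= e0, 0 < k &
    forall d n x : R, - c * d ^+ 2 + e1 * (- p * n ^+ 2 + A * d * (d + n))
      + e2 * (- q * x ^+ 2 + r * n * x + A * d * (d + x))
      <= - k * (d ^+ 2 + n ^+ 2 + x ^+ 2)].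
Proof.
move=> c0 p0 q0 e00 A0 r0.
have pq : 0 < p * q by rewrite mulr_gt0.
have D0 : 0 < 4 * r ^+ 2 + p * q by have := sqr_ge0 r; lra.
(* th = e2 / e1 makes e2 r^2 / q at most e1 p / 4. *)
pose th := p * q / (4 * r ^+ 2 + p * q).
have th0 : 0 < th by rewrite divr_gt0.
have th1 : th <= 1 by rewrite ler_pdivrMr// mul1r; have := sqr_ge0 r; lra.
have thr : th * (r ^+ 2 / q) <= p / 4.
  have -> : th * (r ^+ 2 / q) = p * r ^+ 2 / (4 * r ^+ 2 + p * q).
    by rewrite /th; field; rewrite !gt_eqF.
  rewrite ler_pdivrMr//; have := mulr_ge0 (ltW p0) (ltW pq); lra.
pose S := 2 * A + A ^+ 2 / p + A ^+ 2 / q.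
have Ap : 0 <= A ^+ 2 / p by rewrite divr_ge0 ?sqr_ge0// ltW.
have Aq : 0 <= A ^+ 2 / q by rewrite divr_ge0 ?sqr_ge0// ltW.
have S0 : 0 <= S by rewrite /S; lra.
pose e1 := Num.min e0 (c / (2 * (S + 1))).
have e10 : 0 < e1 by rewrite lt_min e00 divr_gt0// mulr_gt0//; lra.
have e1S : e1 * (S + 1) <= c / 2.
  have : e1 <= c / (2 * (S + 1)) by rewrite ge_min lexx orbT.
  rewrite ler_pdivlMr; last by rewrite mulr_gt0//; lra.
  lra.
pose e2 := th * e1.
have e20 : 0 < e2 by rewrite mulr_gt0.
have e21 : e2 <= e1 by rewrite ler_piMl// ltW.
have e1e : e1 <= e0 by rewrite ge_min lexx.
pose k := Num.min (c / 2) (Num.min (e1 * p / 2) (e2 * q / 2)).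
have k1 : k <= c / 2 by rewrite ge_min lexx.
have k2 : k <= e1 * p / 2 by rewrite !ge_min lexx orbT.
have k3 : k <= e2 * q / 2 by rewrite !ge_min lexx !orbT.
exists e1, e2, k; split.
- by rewrite e10.
- by rewrite e20 (le_trans e21).
- by rewrite !lt_min !divr_gt0// mulr_gt0.
move=> d n x.
have y1 := @young _ A d n _ p0.
have y2 := @young _ r n x _ q0.
have y3 := @young _ A d x _ q0.
have d2 := sqr_ge0 d; have n2 := sqr_ge0 n; have x2 := sqr_ge0 x.
have h1 : e1 * (- p * n ^+ 2 + A * d * (d + n)) <=
    e1 * (- (3 / 4 * p) * n ^+ 2 + (A + A ^+ 2 / p) * d ^+ 2).
  by rewrite ler_pM2l//; lra.
have h2 : e2 * (- q * x ^+ 2 + r * n * x + A * d * (d + x)) <=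
    e2 * (- (q / 2) * x ^+ 2 + r ^+ 2 / q * n ^+ 2 + (A + A ^+ 2 / q) * d ^+ 2).
  by rewrite ler_pM2l//; lra.
have h3 : e2 * (r ^+ 2 / q * n ^+ 2) <= e1 * (p / 4 * n ^+ 2).
  have -> : e2 * (r ^+ 2 / q * n ^+ 2) = e1 * (th * (r ^+ 2 / q) * n ^+ 2).
    by rewrite /e2; ring.
  by rewrite ler_pM2l// ler_wpM2r.
have h4 : e2 * ((A + A ^+ 2 / q) * d ^+ 2) <= e1 * ((A + A ^+ 2 / q) * d ^+ 2).
  by rewrite ler_wpM2r// mulr_ge0// addr_ge0.
have h5 : e1 * (S + 1) * d ^+ 2 <= c / 2 * d ^+ 2 by rewrite ler_wpM2r.
have h5' : 0 <= e1 * d ^+ 2 by rewrite mulr_ge0// ltW.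
have h6 : k * d ^+ 2 <= c / 2 * d ^+ 2 by rewrite ler_wpM2r.
have h7 : k * n ^+ 2 <= e1 * p / 2 * n ^+ 2 by rewrite ler_wpM2r.
have h8 : k * x ^+ 2 <= e2 * q / 2 * x ^+ 2 by rewrite ler_wpM2r.
rewrite /S in h5.
lra.
Qed.

(** * Bounded Lipschitz functions on a box *)

Inductive coordinate := Xi | Vdc | Id | Iq | Vd | Vq | Nu.

Section BoundedLipschitz.
Context {R : realType} {I : Type}.
Implicit Types (u v : I -> R) (h k : (I -> R) -> R).

Definition box (B : R) u := forall i, `|u i| <= B.

(** A single constant for both bounds makes the property stable under products
    without further data. *)
Definition bounded_lipschitz (B : R) h := exists2 A : R, 0 <= A &
  forall u v, box B u -> box B v ->
    `|h u| <= A /\ forall e, (forall i, `|u i - v i| <= e) -> `|h u - h v| <= A * e.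

Context {B : R}.

Lemma bounded_lipschitz_cst (a : R) : I -> bounded_lipschitz B (fun=> a).
Proof.
move=> i0; exists `|a| => // u v _ _; split=> // e h.
by rewrite subrr normr0 mulr_ge0// (le_trans _ (h i0)).
Qed.

Lemma bounded_lipschitz_proj i : bounded_lipschitz B (fun u => u i).
Proof.
exists (Num.max B 1); first by rewrite le_max ler01 orbT.
move=> u v uB vB; split; first by rewrite le_max uB.
move=> e h; apply: le_trans (h i) _.
by rewrite ler_peMl// ?(le_trans _ (h i))// le_max lexx orbT.
Qed.

Lemma bounded_lipschitzN h : bounded_lipschitz B h -> bounded_lipschitz B (fun u => - h u).
Proof.
move=> [A A0 hA]; exists A => // u v uB vB.
have [h1 h2] := hA u v uB vB; split; first by rewrite normrN.
by move=> e /h2; rewrite -opprD normrN.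
Qed.

Lemma bounded_lipschitzD h k : bounded_lipschitz B h -> bounded_lipschitz B k ->
  bounded_lipschitz B (fun u => h u + k u).
Proof.
move=> [A A0 hA] [A' A'0 kA']; exists (A + A'); first exact: addr_ge0.
move=> u v uB vB; have [h1 h2] := hA u v uB vB; have [k1 k2] := kA' u v uB vB.
split; first by apply: le_trans (ler_normD _ _) _; exact: lerD.
move=> e huv; rewrite opprD addrACA mulrDl.
by apply: le_trans (ler_normD _ _) _; apply: lerD; [exact: h2|exact: k2].
Qed.

Lemma bounded_lipschitzM h k : bounded_lipschitz B h -> bounded_lipschitz B k ->
  bounded_lipschitz B (fun u => h u * k u).
Proof.
move=> [A A0 hA] [A' A'0 kA']; exists (2 * (A * A')).
  by rewrite !mulr_ge0.
move=> u v uB vB; have [h1 h2] := hA u v uB vB; have [k1 k2] := kA' u v uB vB.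
have [k3 _] := kA' v u vB uB.
split.
  rewrite normrM; apply: (@le_trans _ _ (A * A')); first exact: ler_pM.
  by rewrite ler_peMl ?mulr_ge0// ler1n.
move=> e huv.
have -> : h u * k u - h v * k v = h u * (k u - k v) + (h u - h v) * k v by ring.
apply: le_trans (ler_normD _ _) _; rewrite !normrM.
have -> : 2 * (A * A') * e = A * (A' * e) + (A * e) * A' by ring.
by apply: lerD; apply: ler_pM => //; [exact: k2|exact: h2].
Qed.

Lemma bounded_on_box h : bounded_lipschitz B h ->
  exists2 A, 0 <= A & forall u, box B u -> `|h u| <= A.
Proof. by move=> [A A0 hA]; exists A => // u uB; case: (hA u u uB uB). Qed.

End BoundedLipschitz.

Ltac prove_bounded_lipschitz := repeat first
  [ apply: bounded_lipschitzD | apply: bounded_lipschitzM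
  | apply: bounded_lipschitzN | exact: bounded_lipschitz_proj
  | exact: (bounded_lipschitz_cst _ Xi) ].

Definition clamp {R : realType} (B y : R) : R := Num.max (- B) (Num.min y B).

Lemma clamp_id (R : realType) (B y : R) : `|y| <= B -> clamp B y = y.
Proof.
by rewrite ler_norml /clamp => /andP[h1 h2]; rewrite (min_idPl h2) (max_idPr h1).
Qed.

Lemma clamp_le (R : realType) (B y : R) : 0 <= B -> `|clamp B y| <= B.
Proof.
move=> B0; rewrite ler_norml /clamp le_max lexx /= ge_max ge_min lexx orbT andbT; lra.
Qed.

Lemma clamp_lipschitz (R : realType) (B y z : R) : `|clamp B y - clamp B z| <= `|y - z|.
Proof.
wlog yz : y z / y <= z => [h|].
  by have [/h//|/ltW/h] := leP y z; rewrite distrC [`|z - y|]distrC.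
rewrite distrC [`|y - z|]distrC [`|z - y|]ger0_norm ?subr_ge0//.
by rewrite ler_norml /clamp /Num.max /Num.min; repeat case: ifPn;
  rewrite -?leNgt => *; apply/andP; split; lra.
Qed.

Lemma ge_summand (R : realFieldType) (a b c d : R) :
  0 <= a -> 0 <= b -> 0 <= c -> 0 <= d ->
  let s := a + b + c + d + 1 in [/\ a <= s, b <= s, c <= s, d <= s & 1 <= s].
Proof. by move=> a0 b0 c0 d0 s; rewrite /s; split; lra. Qed.

(** * The closed loop in error coordinates *)

(** The last field is the stability condition, with the squared norms of the
    equilibrium current (id, iq) and voltage (vd, vq) written out. *)
Record admissible {R : realType} (p : params R) (id iq vd vq : R) : Prop := Admissible {
  _ : 0 < Cdc p; _ : 0 < Gdc p; _ : 0 < Lf p; _ : 0 < Rf p; _ : 0 < Cf p; _ : 0 < Gf p;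
  _ : 0 < Kp p; _ : 0 < Ki p; _ : 0 < Kd p; _ : 0 < omega0 p; _ : 0 < vdc_ref p;
  _ : 0 < kappa_p p; _ : 0 < kappa_i p;
  _ : Cf p ^+ 2 * (vd ^+ 2 + vq ^+ 2) / (4 * Gf p)
    + Lf p ^+ 2 * (id ^+ 2 + iq ^+ 2) / (4 * Rf p) < Gdc p / eta_ref p ^+ 2 }.

Section ErrorSystem.
Context {R : realType} (p : params R) (mu id iq vd vq : R).
Implicit Types (u du : coordinate -> R).

Definition error_output u : R := vdc_ref p * u Iq - iq * u Vdc.

Definition error_input u : R := - (kappa_p p * error_output u) - kappa_i p * u Nu.

(** The closed loop divided by its leading coefficients, in the deviation u from an
    equilibrium with dc voltage [vdc_ref], current (id, iq) and voltage (vd, vq)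
    under the constant modulation mu; [error_input] is the deviation of the
    modulation. *)
Definition error_field u (c : coordinate) : R :=
  let V := vdc_ref p + u Vdc in
  let w := error_input u in
  match c with
  | Xi => u Vdc
  | Vdc => (- ((Gdc p + Kp p) * u Vdc) - Ki p * u Xi - mu / 2 * u Iq
            - w / 2 * (u Iq + iq)) / (Cdc p + Kd p)
  | Id => (- (Rf p * u Id) + eta_ref p * Lf p * (V * u Iq + u Vdc * iq) - u Vd) / Lf p
  | Iq => (- (Rf p * u Iq) - eta_ref p * Lf p * (V * u Id + u Vdc * id)
           + mu / 2 * u Vdc + w / 2 * V - u Vq) / Lf p
  | Vd => (- (Gf p * u Vd) + eta_ref p * Cf p * (V * u Vq + u Vdc * vq) + u Id) / Cf p
  | Vq => (- (Gf p * u Vq) - eta_ref p * Cf p * (V * u Vd + u Vdc * vd) + u Iq) / Cf p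
  | Nu => error_output u
  end.

Definition error_solution (x : R -> coordinate -> R) : Prop :=
  (forall c, x t c @[t --> 0^'+] --> x 0 c) /\
  forall t : R, 0 < t -> forall c, is_derive t 1 (x^~ c) (error_field (x t) c).

(** The coefficient of the integrator state is kappa_i / 2, not kappa_i, because
    the modulation enters the dynamics through its half. *)
Definition energy u : R :=
  (Ki p * u Xi ^+ 2 + (Cdc p + Kd p) * u Vdc ^+ 2
   + Lf p * (u Id ^+ 2 + u Iq ^+ 2) + Cf p * (u Vd ^+ 2 + u Vq ^+ 2)
   + kappa_i p / 2 * u Nu ^+ 2) / 2.

Definition denergy u du : R :=
  Ki p * u Xi * du Xi + (Cdc p + Kd p) * u Vdc * du Vdc
  + Lf p * (u Id * du Id + u Iq * du Iq) + Cf p * (u Vd * du Vd + u Vq * du Vq)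
  + kappa_i p / 2 * u Nu * du Nu.

(** Cross terms that transfer damping to the integrator states: the current
    equation contains - kappa_i v_ref nu / 2, the dc voltage equation - K_i xi. *)
Definition current_cross u : R := Lf p * u Nu * u Iq.
Definition dcurrent_cross u du : R := Lf p * (du Nu * u Iq + u Nu * du Iq).

Definition voltage_cross u : R := (Cdc p + Kd p) * u Xi * u Vdc.
Definition dvoltage_cross u du : R := (Cdc p + Kd p) * (du Xi * u Vdc + u Xi * du Vdc).

Definition damped u : R :=
  `|u Vdc| + `|u Id| + `|u Iq| + `|u Vd| + `|u Vq|.

Section Derivatives.
Context (x : R -> coordinate -> R) (t : R) (du : coordinate -> R)
  (xD : forall c, is_derive t 1 (x^~ c) (du c)).

Lemma is_derive_product (c c' : coordinate) (k : R) :
  is_derive t 1 (fun s => k * x s c * x s c') (k * (du c * x t c' + x t c * du c')).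
Proof.
have h := is_deriveM (is_deriveZ k (xD c)) (xD c').
by apply: (is_derive_eq h); rewrite /= /GRing.scale /=; ring.
Qed.

(** Stated for an arbitrary velocity, so that it applies to the clamped field as
    well as to the error field. *)
Lemma is_derive_energy : is_derive t 1 (fun s => energy (x s)) (denergy (x t) du).
Proof.
have sq c k := is_derive_product c c (k / 2).
pose half_square k c : R -> R := fun s => k / 2 * x s c * x s c.
pose f : R -> R := half_square (Ki p) Xi + half_square (Cdc p + Kd p) Vdc
  + (half_square (Lf p) Id + half_square (Lf p) Iq)
  + (half_square (Cf p) Vd + half_square (Cf p) Vq) + half_square (kappa_i p / 2) Nu.
have -> : (fun s => energy (x s)) = f.
  by apply/funext => s; rewrite /energy /f /half_square !fctE; field.
have h : is_derive t 1 f _ := is_deriveD (is_deriveD (is_deriveD (is_deriveD (sq Xi (Ki p))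
  (sq Vdc (Cdc p + Kd p))) (is_deriveD (sq Id (Lf p)) (sq Iq (Lf p))))
  (is_deriveD (sq Vd (Cf p)) (sq Vq (Cf p)))) (sq Nu (kappa_i p / 2)).
by apply: (is_derive_eq h); rewrite /denergy; field.
Qed.

Lemma is_derive_current_cross :
  is_derive t 1 (fun s => current_cross (x s)) (dcurrent_cross (x t) du).
Proof. exact: is_derive_product. Qed.

Lemma is_derive_voltage_cross :
  is_derive t 1 (fun s => voltage_cross (x s)) (dvoltage_cross (x t) du).
Proof. exact: is_derive_product. Qed.

End Derivatives.

Section RightContinuity.
Context (x : R -> coordinate -> R)
  (x0 : forall c, x t c @[t --> 0^'+] --> x 0 c).

Lemma cvg_product (c c' : coordinate) (k : R) :
  k * x t c * x t c' @[t --> 0^'+] --> k * x 0 c * x 0 c'.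
Proof. exact: cvgM (cvgM (cvg_cst k) (x0 c)) (x0 c'). Qed.

Lemma cvg_energy : energy (x t) @[t --> 0^'+] --> energy (x 0).
Proof.
have sq c k := cvg_product c c (k / 2).
have h := cvgD (cvgD (cvgD (cvgD (sq Xi (Ki p))
  (sq Vdc (Cdc p + Kd p))) (cvgD (sq Id (Lf p)) (sq Iq (Lf p))))
  (cvgD (sq Vd (Cf p)) (sq Vq (Cf p)))) (sq Nu (kappa_i p / 2)).
have E u : energy u = Ki p / 2 * u Xi * u Xi + (Cdc p + Kd p) / 2 * u Vdc * u Vdc
  + (Lf p / 2 * u Id * u Id + Lf p / 2 * u Iq * u Iq)
  + (Cf p / 2 * u Vd * u Vd + Cf p / 2 * u Vq * u Vq)
  + kappa_i p / 2 / 2 * u Nu * u Nu by rewrite /energy; field.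
rewrite E; under eq_fun do rewrite E.
exact: h.
Qed.

End RightContinuity.

Context (adm : admissible p id iq vd vq).

Let Cdc_gt0 : 0 < Cdc p. Proof. by case: adm. Qed.
Let Gdc_gt0 : 0 < Gdc p. Proof. by case: adm. Qed.
Let L_gt0 : 0 < Lf p. Proof. by case: adm. Qed.
Let R_gt0 : 0 < Rf p. Proof. by case: adm. Qed.
Let C_gt0 : 0 < Cf p. Proof. by case: adm. Qed.
Let G_gt0 : 0 < Gf p. Proof. by case: adm. Qed.
Let Kp_gt0 : 0 < Kp p. Proof. by case: adm. Qed.
Let Ki_gt0 : 0 < Ki p. Proof. by case: adm. Qed.
Let Kd_gt0 : 0 < Kd p. Proof. by case: adm. Qed.
Let omega0_gt0 : 0 < omega0 p. Proof. by case: adm. Qed.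
Let vdc_ref_gt0 : 0 < vdc_ref p. Proof. by case: adm. Qed.
Let kappa_p_gt0 : 0 < kappa_p p. Proof. by case: adm. Qed.
Let kappa_i_gt0 : 0 < kappa_i p. Proof. by case: adm. Qed.

Let Mdc_gt0 : 0 < Cdc p + Kd p. Proof. exact: addr_gt0. Qed.

(** The products of the modulation with the state are lossless and cancel, up to
    half the input times the output; the choice of the input turns this into
    - kappa_p y^2 / 2 and the derivative of the integrator energy. *)
Lemma denergy_error_field u : denergy u (error_field u) =
  - (Gdc p + Kp p) * u Vdc ^+ 2 - Rf p * (u Id ^+ 2 + u Iq ^+ 2)
  - Gf p * (u Vd ^+ 2 + u Vq ^+ 2)
  + eta_ref p * Lf p * u Vdc * (u Id * iq - u Iq * id)
  + eta_ref p * Cf p * u Vdc * (u Vd * vq - u Vq * vd)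
  - kappa_p p / 2 * error_output u ^+ 2.
Proof.
rewrite /denergy /error_field /error_input /error_output.
have := Mdc_gt0; move: L_gt0 C_gt0 => /lt0r_neq0 L0 /lt0r_neq0 C0 /lt0r_neq0 M0.
field; by rewrite ?L0 ?C0 ?M0.
Qed.

(** A fraction [th] < 1 of the resistive losses pays for the frame-speed terms at
    a cost of at most G_dc in the dc voltage, by the strict inequality of the
    stability condition; the rest of the losses and the gain K_p remain. *)
Lemma dissipation : exists2 c, 0 < c &
  forall u, denergy u (error_field u) <= - c * damped u ^+ 2.
Proof.
have eta0 : 0 < eta_ref p by rewrite divr_gt0.
have [_ _ _ _ _ _ _ _ _ _ _ _ _] := adm.
set SC := Cf p ^+ 2 * _ / _; set SL := Lf p ^+ 2 * _ / _ => stabS.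
have SC0 : 0 <= SC by rewrite divr_ge0 ?mulr_ge0 ?addr_ge0 ?sqr_ge0// ltW.
have SL0 : 0 <= SL by rewrite divr_ge0 ?mulr_ge0 ?addr_ge0 ?sqr_ge0// ltW.
pose S := eta_ref p ^+ 2 * (SC + SL).
have S0 : 0 <= S by rewrite mulr_ge0 ?sqr_ge0 ?addr_ge0.
have SG : S < Gdc p.
  by rewrite /S mulrC -ltr_pdivlMr ?exprn_gt0.
(* The midpoint of S / G_dc and 1: it is positive even when S = 0. *)
pose th := (S + Gdc p) / (2 * Gdc p).
have th0 : 0 < th by rewrite divr_gt0 ?mulr_gt0//; lra.
have th1 : th < 1 by rewrite ltr_pdivrMr ?mulr_gt0//; lra.
have Sth : S / th <= Gdc p.
  rewrite ler_pdivrMr// /th.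
  have -> : Gdc p * ((S + Gdc p) / (2 * Gdc p)) = (S + Gdc p) / 2.
    by field; rewrite gt_eqF.
  lra.
pose c := Num.min (Kp p) (Num.min ((1 - th) * Rf p) ((1 - th) * Gf p)).
have c0 : 0 < c by rewrite !lt_min Kp_gt0 !mulr_gt0 ?subr_gt0.
have cK : c <= Kp p by rewrite ge_min lexx.
have cR : c <= (1 - th) * Rf p by rewrite !ge_min lexx !orbT.
have cG : c <= (1 - th) * Gf p by rewrite !ge_min lexx !orbT.
(* The 5 compares the square of a sum of five terms with the sum of squares. *)
exists (c / 5); first by rewrite divr_gt0.
move=> u; rewrite denergy_error_field.
have y1 := @gyroscopic_young _ (Lf p) (eta_ref p) (th * Rf p) id iq
  (u Id) (u Iq) (u Vdc) (mulr_gt0 th0 R_gt0).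
have y2 := @gyroscopic_young _ (Cf p) (eta_ref p) (th * Gf p) vd vq
  (u Vd) (u Vq) (u Vdc) (mulr_gt0 th0 G_gt0).
have e1 : Lf p ^+ 2 * (id ^+ 2 + iq ^+ 2) / (4 * (th * Rf p)) = SL / th.
  by rewrite /SL; field; rewrite !gt_eqF.
have e2 : Cf p ^+ 2 * (vd ^+ 2 + vq ^+ 2) / (4 * (th * Gf p)) = SC / th.
  by rewrite /SC; field; rewrite !gt_eqF.
rewrite e1 in y1; rewrite e2 in y2.
have y3 : (eta_ref p ^+ 2 * (SL / th) + eta_ref p ^+ 2 * (SC / th)) * u Vdc ^+ 2
    <= Gdc p * u Vdc ^+ 2.
  rewrite ler_wpM2r ?sqr_ge0//; apply: le_trans Sth.
  by rewrite le_eqVlt; apply/orP; left; apply/eqP; rewrite /S; field; rewrite gt_eqF.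
have yy : 0 <= kappa_p p / 2 * error_output u ^+ 2.
  by rewrite mulr_ge0 ?sqr_ge0// divr_ge0// ltW.
have h1 : c * u Vdc ^+ 2 <= Kp p * u Vdc ^+ 2 by rewrite ler_wpM2r ?sqr_ge0.
have h2 : c * (u Id ^+ 2 + u Iq ^+ 2) <= (1 - th) * Rf p * (u Id ^+ 2 + u Iq ^+ 2).
  by rewrite ler_wpM2r ?addr_ge0 ?sqr_ge0.
have h3 : c * (u Vd ^+ 2 + u Vq ^+ 2) <= (1 - th) * Gf p * (u Vd ^+ 2 + u Vq ^+ 2).
  by rewrite ler_wpM2r ?addr_ge0 ?sqr_ge0.
have h4 : c / 5 * damped u ^+ 2 <=
    c * (u Vdc ^+ 2 + u Id ^+ 2 + u Iq ^+ 2 + u Vd ^+ 2 + u Vq ^+ 2).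
  rewrite -mulrA ler_pM2l// ler_pdivrMl//.
  rewrite -!(real_normK (num_real (u _))) /damped.
  move: (`|u Vdc|) (`|u Id|) (`|u Iq|) (`|u Vd|) (`|u Vq|) => a1 a2 a3 a4 a5.
  rewrite -subr_ge0.
  have -> : 5 * (a1 ^+ 2 + a2 ^+ 2 + a3 ^+ 2 + a4 ^+ 2 + a5 ^+ 2)
      - (a1 + a2 + a3 + a4 + a5) ^+ 2 =
    (a1 - a2) ^+ 2 + (a1 - a3) ^+ 2 + (a1 - a4) ^+ 2 + (a1 - a5) ^+ 2 + (a2 - a3) ^+ 2
    + (a2 - a4) ^+ 2 + (a2 - a5) ^+ 2 + (a3 - a4) ^+ 2 + (a3 - a5) ^+ 2 + (a4 - a5) ^+ 2.
    by ring.
  by rewrite !addr_ge0 ?sqr_ge0.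
lra.
Qed.

Lemma damped_linear (u : coordinate -> R) (A k1 k2 k3 k4 k5 : R) :
  `|k1| <= A -> `|k2| <= A -> `|k3| <= A -> `|k4| <= A -> `|k5| <= A ->
  `|u Vdc * k1 + u Id * k2 + u Iq * k3 + u Vd * k4 + u Vq * k5| <= A * damped u.
Proof.
move=> h1 h2 h3 h4 h5; rewrite [A * _]mulrC /damped !mulrDl.
do 4! (apply: le_trans (ler_normD _ _) _; apply: lerD; last by rewrite normrM ler_wpM2l).
by rewrite normrM ler_wpM2l.
Qed.

Lemma damped_ge0 u : 0 <= damped u. Proof. by rewrite /damped !addr_ge0. Qed.

(** Apart from the damping of nu, each term of this derivative has a factor among
    the dissipated coordinates; the remaining factors are bounded on the box. *)
Lemma dcurrent_cross_le (B : R) : exists2 A, 0 <= A & forall u, box B u ->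
  dcurrent_cross u (error_field u) <=
    - (kappa_i p * vdc_ref p / 2) * `|u Nu| ^+ 2 + A * damped u * (damped u + `|u Nu|).
Proof.
pose k1 u := - eta_ref p * Lf p * id + mu / 2
  + kappa_p p * iq / 2 * (vdc_ref p + u Vdc) - kappa_i p / 2 * u Nu.
pose k2 u := - eta_ref p * Lf p * (vdc_ref p + u Vdc).
pose k3 u := - Rf p - kappa_p p * vdc_ref p / 2 * (vdc_ref p + u Vdc).
have [A1 A10 hA1] : exists2 A, 0 <= A & forall u, box B u -> `|k1 u| <= A.
  by apply: bounded_on_box; rewrite /k1; prove_bounded_lipschitz.
have [A2 A20 hA2] : exists2 A, 0 <= A & forall u, box B u -> `|k2 u| <= A.
  by apply: bounded_on_box; rewrite /k2; prove_bounded_lipschitz.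
have [A3 A30 hA3] : exists2 A, 0 <= A & forall u, box B u -> `|k3 u| <= A.
  by apply: bounded_on_box; rewrite /k3; prove_bounded_lipschitz.
pose A4 := `|- (Lf p * iq)| + `|Lf p * vdc_ref p|.
have A40 : 0 <= A4 by rewrite addr_ge0.
pose A := A1 + A2 + A3 + A4 + 1.
exists A => [|u uB]; first by rewrite /A !addr_ge0.
have -> : dcurrent_cross u (error_field u) =
    - (kappa_i p * vdc_ref p / 2) * u Nu ^+ 2
    + (u Vdc * - (Lf p * iq) + u Id * 0 + u Iq * (Lf p * vdc_ref p) + u Vd * 0 + u Vq * 0)
      * u Iq
    + (u Vdc * k1 u + u Id * k2 u + u Iq * k3 u + u Vd * 0 + u Vq * - 1) * u Nu.
  rewrite /dcurrent_cross /error_field /error_input /error_output /k1 /k2 /k3.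
  by field; rewrite gt_eqF.
have := hA1 u uB; have := hA2 u uB; have := hA3 u uB => b3 b2 b1.
have ab1 := normr_ge0 (- (Lf p * iq)); have ab2 := normr_ge0 (Lf p * vdc_ref p).
have l1 := @damped_linear u A (- (Lf p * iq)) 0 (Lf p * vdc_ref p) 0 0.
have l2 := @damped_linear u A (k1 u) (k2 u) (k3 u) 0 (- 1).
rewrite !normr0 in l1 l2; rewrite normrN normr1 in l2.
have [AA1 AA2 AA3 AA4 A1le] : [/\ A1 <= A, A2 <= A, A3 <= A, A4 <= A & 1 <= A].
  exact: ge_summand.
have A0 : 0 <= A := le_trans A10 AA1.
have {}l1 :
    `|u Vdc * - (Lf p * iq) + u Id * 0 + u Iq * (Lf p * vdc_ref p) + u Vd * 0 + u Vq * 0|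
    <= A * damped u.
  by apply: l1 => //; apply: le_trans AA4; rewrite /A4 ?lerDl ?lerDr.
have {}l2 : `|u Vdc * k1 u + u Id * k2 u + u Iq * k3 u + u Vd * 0 + u Vq * - 1| <= A * damped u.
  by apply: l2 => //; exact: le_trans AA3 || exact: le_trans AA2 || exact: le_trans AA1.
have IqD : `|u Iq| <= damped u.
  have := normr_ge0 (u Vdc); have := normr_ge0 (u Id); have := normr_ge0 (u Vd).
  have := normr_ge0 (u Vq); rewrite /damped; lra.
rewrite real_normK ?num_real// -addrA lerD2l [_ * (damped u + _)]mulrDr.
apply: lerD; apply: le_trans (ler_norm _) _; rewrite normrM.
  by apply: ler_pM.
by apply: ler_wpM2r.
Qed.

(** The one term without a dissipated factor, besides the damping of xi, is the
    product of xi and nu coming from the integrator acting on the equilibrium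
    current. *)
Lemma dvoltage_cross_le (B : R) : exists2 A, 0 <= A & forall u, box B u ->
  dvoltage_cross u (error_field u) <=
    - Ki p * `|u Xi| ^+ 2 + kappa_i p * `|iq| / 2 * `|u Nu| * `|u Xi|
    + A * damped u * (damped u + `|u Xi|).
Proof.
pose k1 := - (Gdc p + Kp p) - kappa_p p * iq ^+ 2 / 2.
pose k3 u := - mu / 2 + kappa_p p / 2 * error_output u + kappa_i p / 2 * u Nu
  + kappa_p p * iq * vdc_ref p / 2.
have [A3 A30 hA3] : exists2 A, 0 <= A & forall u, box B u -> `|k3 u| <= A.
  by apply: bounded_on_box; rewrite /k3 /error_output; prove_bounded_lipschitz.
pose A := (Cdc p + Kd p) + `|k1| + A3.
have M0 := Mdc_gt0.
have A0 : 0 <= A by rewrite /A !addr_ge0// ltW.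
exists A => // u uB.
have -> : dvoltage_cross u (error_field u) =
    - Ki p * u Xi ^+ 2 + kappa_i p * iq / 2 * u Nu * u Xi
    + (u Vdc * (Cdc p + Kd p) + u Id * 0 + u Iq * 0 + u Vd * 0 + u Vq * 0) * u Vdc
    + (u Vdc * k1 + u Id * 0 + u Iq * k3 u + u Vd * 0 + u Vq * 0) * u Xi.
  rewrite /dvoltage_cross /error_field /error_input /k3 /k1 /error_output.
  by field; rewrite gt_eqF.
have b3 := hA3 u uB; have b1 := normr_ge0 k1.
have l1 := @damped_linear u A (Cdc p + Kd p) 0 0 0 0.
have l2 := @damped_linear u A k1 0 (k3 u) 0 0.
rewrite !normr0 in l1 l2; rewrite gtr0_norm// in l1.
have {}l1 : `|u Vdc * (Cdc p + Kd p) + u Id * 0 + u Iq * 0 + u Vd * 0 + u Vq * 0| <= A * damped u.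
  by apply: l1 => //; rewrite /A -addrA lerDl addr_ge0.
have {}l2 : `|u Vdc * k1 + u Id * 0 + u Iq * k3 u + u Vd * 0 + u Vq * 0| <= A * damped u.
  apply: l2 => //; rewrite /A; first by rewrite addrAC lerDr addr_ge0// ltW.
  by apply: le_trans b3 _; rewrite lerDr addr_ge0// ltW.
have VD : `|u Vdc| <= damped u.
  have := normr_ge0 (u Iq); have := normr_ge0 (u Id); have := normr_ge0 (u Vd).
  have := normr_ge0 (u Vq); rewrite /damped; lra.
rewrite real_normK ?num_real// [_ * (damped u + _)]mulrDr -[X in X <= _]addrA.
apply: lerD.
  apply: lerD => //; apply: le_trans (ler_norm _) _.
  rewrite !normrM normfV (ger0_norm (ltW kappa_i_gt0)).
  by rewrite [`|2|]ger0_norm.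
apply: lerD; apply: le_trans (ler_norm _) _; rewrite normrM.
  by apply: ler_pM.
by apply: ler_wpM2r.
Qed.

Lemma energy_ge0 u : 0 <= energy u.
Proof.
have := Mdc_gt0 => M0.
rewrite /energy divr_ge0//.
by do ![exact: sqr_ge0 | apply: addr_ge0 | exact: ltW | rewrite invr_ge0 | apply: mulr_ge0].
Qed.

Lemma sqr_coordinate_le : exists2 K, 0 < K & forall u c, u c ^+ 2 <= K * energy u.
Proof.
have M0 := Mdc_gt0.
pose K := 2 / Ki p + 2 / (Cdc p + Kd p) + 2 / Lf p + 2 / Cf p + 4 / kappa_i p.
have i1 : 0 < 2 / Ki p by rewrite divr_gt0.
have i2 : 0 < 2 / (Cdc p + Kd p) by rewrite divr_gt0.
have i3 : 0 < 2 / Lf p by rewrite divr_gt0.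
have i4 : 0 < 2 / Cf p by rewrite divr_gt0.
have i5 : 0 < 4 / kappa_i p by rewrite divr_gt0.
exists K => [|u c]; first by rewrite /K !addr_gt0.
have E0 := energy_ge0 u.
have key (k w : R) : 0 < w -> 2 / w <= K -> w * k / 2 <= energy u -> k <= K * energy u.
  move=> w0 wK kE; apply: (@le_trans _ _ (2 / w * energy u)); last exact: ler_wpM2r.
  rewrite -ler_pdivrMl ?divr_gt0// invfM invrK; lra.
have s1 := mulr_ge0 (ltW Ki_gt0) (sqr_ge0 (u Xi)).
have s2 := mulr_ge0 (ltW M0) (sqr_ge0 (u Vdc)).
have s3 := mulr_ge0 (ltW L_gt0) (sqr_ge0 (u Id)).
have s4 := mulr_ge0 (ltW L_gt0) (sqr_ge0 (u Iq)).
have s5 := mulr_ge0 (ltW C_gt0) (sqr_ge0 (u Vd)).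
have s6 := mulr_ge0 (ltW C_gt0) (sqr_ge0 (u Vq)).
have s7 := mulr_ge0 (ltW kappa_i_gt0) (sqr_ge0 (u Nu)).
case: c.
- by apply: (key _ (Ki p)) => //; rewrite ?/K /energy; lra.
- by apply: (key _ (Cdc p + Kd p)) => //; rewrite ?/K /energy; lra.
- by apply: (key _ (Lf p)) => //; rewrite ?/K /energy; lra.
- by apply: (key _ (Lf p)) => //; rewrite ?/K /energy; lra.
- by apply: (key _ (Cf p)) => //; rewrite ?/K /energy; lra.
- by apply: (key _ (Cf p)) => //; rewrite ?/K /energy; lra.
- apply: (key _ (kappa_i p / 2)); first by rewrite divr_gt0.
    by rewrite invfM invrK mulrCA -natrM mulrC /K; lra.
  rewrite /energy; lra.
Qed.

Lemma energy_le_sqr : exists2 K, 0 < K & forall u,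
  energy u <= K * (damped u ^+ 2 + `|u Nu| ^+ 2 + `|u Xi| ^+ 2).
Proof.
have M0 := Mdc_gt0.
pose K := Ki p + (Cdc p + Kd p) + 2 * Lf p + 2 * Cf p + kappa_i p.
exists K => [|u]; first by rewrite /K !addr_gt0 ?mulr_gt0.
set S := _ + _ + _.
have sq c : u c ^+ 2 <= S.
  have dS : damped u ^+ 2 <= S by rewrite /S -addrA lerDl addr_ge0// sqr_ge0.
  rewrite -real_normK ?num_real//.
  have [c1|[c2|cd]] : c = Xi \/ c = Nu \/ `|u c| <= damped u.
    case: c; [by left| right; right| right; right| right; right| right; right| right; right
      | by right; left];
    by have := normr_ge0 (u Iq); have := normr_ge0 (u Id); have := normr_ge0 (u Vd);
       have := normr_ge0 (u Vq); have := normr_ge0 (u Vdc); rewrite /damped; lra.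
  - by rewrite c1 /S lerDr addr_ge0// sqr_ge0.
  - by rewrite c2 /S addrAC lerDr addr_ge0// sqr_ge0.
  - by apply: le_trans dS; rewrite ler_sqr ?nnegrE// damped_ge0.
have S0 : 0 <= S by apply: le_trans (sq Xi); exact: sqr_ge0.
have b1 := ler_wpM2l (ltW Ki_gt0) (sq Xi).
have b2 := ler_wpM2l (ltW M0) (sq Vdc).
have b3 := ler_wpM2l (ltW L_gt0) (sq Id).
have b4 := ler_wpM2l (ltW L_gt0) (sq Iq).
have b5 := ler_wpM2l (ltW C_gt0) (sq Vd).
have b6 := ler_wpM2l (ltW C_gt0) (sq Vq).
have b7 := ler_wpM2l (ltW kappa_i_gt0) (sq Nu).
have c1 := mulr_ge0 (ltW Ki_gt0) S0.
have c2 := mulr_ge0 (ltW M0) S0.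
have c3 := mulr_ge0 (ltW L_gt0) S0.
have c4 := mulr_ge0 (ltW C_gt0) S0.
have c5 := mulr_ge0 (ltW kappa_i_gt0) S0.
rewrite /energy /K; lra.
Qed.

(** The weights depend on the box, so this function is strict only on bounded
    sets; this is enough, because the energy confines each solution to a box. *)
Lemma strict_lyapunov (B : R) : exists e1 e2 k, 0 < k /\ forall u,
  let W := energy u + e1 * current_cross u + e2 * voltage_cross u in
  energy u <= 2 * W /\
  (box B u -> denergy u (error_field u) + e1 * dcurrent_cross u (error_field u)
     + e2 * dvoltage_cross u (error_field u) <= - k * W).
Proof.
have [c c0 hc] := dissipation.
have [K K0 hK] := sqr_coordinate_le.
have [K' K'0 hK'] := energy_le_sqr.
have [A1 A10 hA1] := dcurrent_cross_le B.
have [A2 A20 hA2] := dvoltage_cross_le B.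
have M0 := Mdc_gt0.
pose A := A1 + A2.
(* With weights below e0, each cross term is at most a quarter of the energy. *)
pose e0 := (4 * K * (Lf p + (Cdc p + Kd p)))^-1.
have D0 : 0 < 4 * K * (Lf p + (Cdc p + Kd p)) by rewrite !mulr_gt0// addr_gt0.
have e00 : 0 < e0 by rewrite invr_gt0.
have [|||e1 [e2 [k [/andP[e10 e1e] /andP[e20 e2e] k0 hk]]]] :=
  @cross_weights _ c (kappa_i p * vdc_ref p / 2) (Ki p) A
    (kappa_i p * `|iq| / 2) e0 c0 _ Ki_gt0 e00.
- by rewrite divr_gt0// mulr_gt0.
- exact: addr_ge0.
- by rewrite divr_ge0// mulr_ge0// ltW.
exists e1, e2, (k / (2 * K')); split; first by rewrite divr_gt0// mulr_gt0.
move=> u W.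
have E0 := energy_ge0 u.
have cross (m e : R) c1 c2 : 0 < m -> 0 < e -> m <= Lf p + (Cdc p + Kd p) -> e <= e0 ->
    `|e * (m * u c1 * u c2)| <= energy u / 4.
  move=> m0 e'0 mM ee.
  have h1 : `|u c1 * u c2| <= K * energy u.
    have := hK u c1; have := hK u c2.
    rewrite normrM -(real_normK (num_real (u c1))) -(real_normK (num_real (u c2))).
    have := sqr_ge0 (`|u c1| - `|u c2|); rewrite sqrrB; lra.
  rewrite -mulrA mulrA normrM gtr0_norm ?mulr_gt0//.
  apply: (@le_trans _ _ (e0 * (Lf p + (Cdc p + Kd p)) * (K * energy u))).
    by apply: ler_pM => //; [rewrite mulr_ge0// ltW|apply: ler_pM => //; exact: ltW].
  rewrite le_eqVlt; apply/orP; left; apply/eqP; rewrite /e0; field.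
  by rewrite !gt_eqF// addr_gt0.
have cL := cross (Lf p) e1 Nu Iq L_gt0 e10.
have cM := cross (Cdc p + Kd p) e2 Xi Vdc M0 e20.
have {}cL : `|e1 * current_cross u| <= energy u / 4 by apply: cL => //; rewrite lerDl ltW.
have {}cM : `|e2 * voltage_cross u| <= energy u / 4 by apply: cM => //; rewrite lerDr ltW.
move: cL cM; rewrite !ler_norml => /andP[cL1 cL2] /andP[cM1 cM2].
have WE : W <= 2 * energy u by rewrite /W; lra.
split; first by rewrite /W; lra.
move=> uB.
have d0 := damped_ge0 u.
have h1 := hc u; have h2 := hA1 u uB; have h3 := hA2 u uB.
have h4 := hk (damped u) `|u Nu| `|u Xi|.
have h2' : A1 * damped u * (damped u + `|u Nu|) <= A * damped u * (damped u + `|u Nu|).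
  by rewrite !ler_wpM2r ?addr_ge0// /A lerDl.
have h3' : A2 * damped u * (damped u + `|u Xi|) <= A * damped u * (damped u + `|u Xi|).
  by rewrite !ler_wpM2r ?addr_ge0// /A lerDr.
have {h2 h2'}h2 := ler_wpM2l (ltW e10) (le_trans h2 (lerD (lexx _) h2')).
have {h3 h3'}h3 := ler_wpM2l (ltW e20) (le_trans h3 (lerD (lexx _) h3')).
apply: le_trans (lerD (lerD h1 h2) h3) _.
apply: le_trans h4 _.
have h5 := hK' u.
rewrite !mulNr lerN2 mulrAC ler_pdivrMr ?mulr_gt0// -[leRHS]mulrA ler_pM2l//.
apply: (le_trans WE); rewrite [leRHS]mulrCA ler_pM2l// [leRHS]mulrC.
exact: h5.
Qed.

Lemma energy_solution_nonincreasing (x : R -> coordinate -> R) (t : R) :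
  error_solution x -> 0 <= t -> energy (x t) <= energy (x 0).
Proof.
move=> [x0 xD] t0; have [c c0 hc] := dissipation.
apply: (@nonincreasing_of_derive_le0 _ (fun t => energy (x t))
  (fun t => denergy (x t) (error_field (x t)))) => //.
- exact: cvg_energy.
- by move=> s s0; apply: is_derive_energy; exact: xD.
- move=> s s0; apply: le_trans (hc _) _.
  by rewrite mulNr oppr_le0 mulr_ge0 ?sqr_ge0// ltW.
Qed.

Lemma error_solution_to_zero (x : R -> coordinate -> R) (c : coordinate) :
  error_solution x -> x t c @[t --> +oo] --> 0.
Proof.
move=> xs; have [x0 xD] := xs.
have [K K0 hK] := sqr_coordinate_le.
pose B := 1 + K * energy (x 0).
have KE : 0 <= K * energy (x 0) by rewrite mulr_ge0 ?energy_ge0// ltW.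
have xB (t : R) : 0 <= t -> box B (x t).
  move=> t0 i; rewrite -ler_sqr ?nnegrE//; last by rewrite addr_ge0.
  rewrite real_normK ?num_real//; apply: le_trans (hK _ _) _.
  apply: (@le_trans _ _ (K * energy (x 0))).
    by rewrite ler_pM2l//; exact: energy_solution_nonincreasing.
  by have := sqr_ge0 (K * energy (x 0)); rewrite /B sqrrD; lra.
have [e1 [e2 [k [k0 hW]]]] := strict_lyapunov B.
pose W t := energy (x t) + e1 * current_cross (x t) + e2 * voltage_cross (x t).
pose dW t := let F := error_field (x t) in denergy (x t) F
  + e1 * dcurrent_cross (x t) F + e2 * dvoltage_cross (x t) F.
have W0 : W t @[t --> +oo] --> 0.
  apply: (@decay_to_zero _ W dW k k0) => [|t t0|t t0].
  - apply: cvgD; first apply: cvgD; first exact: cvg_energy.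
      by apply: cvgM; [exact: cvg_cst|exact: cvg_product].
    by apply: cvgM; [exact: cvg_cst|exact: cvg_product].
  - apply: is_deriveD; first apply: is_deriveD.
    + by apply: is_derive_energy; exact: xD.
    + by apply: is_deriveZ; apply: is_derive_current_cross; exact: xD.
    + by apply: is_deriveZ; apply: is_derive_voltage_cross; exact: xD.
  - have [h1 h2] := hW (x t); split; last exact: h2 (xB _ (ltW t0)).
    by have := energy_ge0 (x t); rewrite /W; lra.
apply/cvgrPdist_lt => e e0.
have ep : 0 < e ^+ 2 / (2 * K) by rewrite divr_gt0 ?exprn_gt0 ?mulr_gt0.
move/cvgrPdist_lt : W0 => /(_ _ ep) W0; near=> t.
rewrite sub0r normrN -ltr_sqr ?nnegrE// ?(ltW e0)// real_normK ?num_real//.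
apply: le_lt_trans (hK _ _) _.
have [h1 _] := hW (x t).
apply: (@le_lt_trans _ _ (K * (2 * W t))); first by rewrite ler_pM2l.
have We : `|0 - W t| < e ^+ 2 / (2 * K) by near: t; exact: W0.
rewrite sub0r normrN ltr_pdivlMr ?mulr_gt0// in We.
apply: le_lt_trans We; rewrite mulrA [leLHS]mulrC [K * 2]mulrC.
by rewrite ler_wpM2r ?ler_norm// mulr_ge0// ltW.
Unshelve. all: by end_near. Qed.

(** The clamped field agrees with the error field as long as the energy is at most
    E0 + 1, and there the energy decreases: the solution of the clamped system
    never reaches the region where the two fields differ. *)
Lemma error_system_complete (u0 : coordinate -> R) :
  exists x : R -> coordinate -> R, x 0 = u0 /\ error_solution x.
Proof.
have [K K0 hK] := sqr_coordinate_le.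
pose E0 := energy u0.
have E00 : 0 <= E0 by exact: energy_ge0.
pose B := 1 + K * (E0 + 1).
have KE : 0 <= K * (E0 + 1) by rewrite mulr_ge0 ?addr_ge0// ltW.
have B0 : 0 <= B by rewrite addr_ge0.
have boxB u : energy u <= E0 + 1 -> box B u.
  move=> uE i; rewrite -ler_sqr ?nnegrE//.
  rewrite real_normK ?num_real//; apply: le_trans (hK _ _) _.
  apply: (@le_trans _ _ (K * (E0 + 1))); first by rewrite ler_pM2l.
  by have := sqr_ge0 (K * (E0 + 1)); rewrite /B sqrrD; lra.
have FL c : bounded_lipschitz B (error_field ^~ c).
  by case: c; rewrite /error_field /error_input /error_output /=; prove_bounded_lipschitz.
have [Lc hLc] := choice (fun c =>
  let: ex_intro2 A A0 hA := FL c in ex_intro _ A (conj A0 hA)).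
pose L := Lc Xi + Lc Vdc + Lc Id + Lc Iq + Lc Vd + Lc Vq + Lc Nu + 1.
have L0 c : 0 <= Lc c by case: (hLc c).
have LcL c : Lc c <= L.
  have := L0 Xi; have := L0 Vdc; have := L0 Id; have := L0 Iq; have := L0 Vd;
  have := L0 Vq; have := L0 Nu; case: c; rewrite /L; lra.
pose cl u (c : coordinate) := clamp B (u c).
have clB u : box B (cl u) by move=> c; exact: clamp_le.
have [|u c|u v e uv c|x [x0 xD]] :=
  @picard_lindelof R coordinate (fun u => error_field (cl u)) L L u0.
- by rewrite /L ltr_wpDl// !addr_ge0.
- by apply: le_trans (LcL c); case: (hLc c) => _ h; case: (h _ _ (clB u) (clB u)).
- have [_ h] := hLc c; have [_ {}h] := h _ _ (clB u) (clB v).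
  apply: (@le_trans _ _ (Lc c * e)).
    by apply: h => j; apply: le_trans (uv j); exact: clamp_lipschitz.
  by rewrite ler_wpM2r// (le_trans _ (uv Xi)).
have [c c0 hc] := dissipation.
have xE (t : R) : 0 <= t -> energy (x t) <= E0.
  apply: (@barrier _ (fun t => energy (x t))
    (fun t => denergy (x t) (error_field (cl (x t)))) E0 (E0 + 1)).
  - by rewrite ltrDl.
  - by move=> s s0; apply: is_derive_energy => i; exact: xD.
  - move=> s s0 /boxB sB.
    have -> : cl (x s) = x s by apply/funext => i; exact: clamp_id.
    by apply: le_trans (hc _) _; rewrite mulNr oppr_le0 mulr_ge0 ?sqr_ge0// ltW.
  - by rewrite x0.
exists x; split => //; split.
  by move=> i; apply: is_derive_cvg_right; exact: xD.
move=> t t0 i; have := xD t i (ltW t0).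
have -> // : cl (x t) = x t.
apply/funext => j; apply: clamp_id; apply: boxB.
by apply: le_trans (xE t (ltW t0)) _; rewrite lerDl.
Qed.

(** Where the field vanishes the energy is stationary, so the dissipated
    coordinates are 0; the current and dc voltage equations then force nu = 0 and
    xi = 0. *)
Lemma error_field_eq0 u : (forall c, error_field u c = 0) -> forall c, u c = 0.
Proof.
move=> F0; have [k k0 hk] := dissipation.
have d0 : damped u = 0.
  apply/eqP; rewrite -sqrf_eq0 eq_le sqr_ge0 andbT.
  have := hk u; have -> : denergy u (error_field u) = 0 by rewrite /denergy !F0; ring.
  by rewrite mulNr oppr_ge0 pmulr_rle0.
have [V0 [I0 [I1 [U0 U1]]]] : u Vdc = 0 /\ u Id = 0 /\ u Iq = 0 /\ u Vd = 0 /\ u Vq = 0.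
  have := normr_ge0 (u Iq); have := normr_ge0 (u Id); have := normr_ge0 (u Vd).
  have := normr_ge0 (u Vq); have := normr_ge0 (u Vdc) => h1 h2 h3 h4 h5.
  by move: d0; rewrite /damped => d0; do !split; apply/eqP; rewrite -normr_eq0; apply/eqP; lra.
have N0 : u Nu = 0.
  have := F0 Iq; rewrite /error_field /error_input /error_output V0 I0 I1 U1.
  move=> /eqP; rewrite mulf_eq0 invr_eq0 (gt_eqF L_gt0) orbF => /eqP h.
  have : kappa_i p * vdc_ref p * u Nu = 0 by lra.
  by move=> /eqP; rewrite !mulf_eq0 (gt_eqF kappa_i_gt0) (gt_eqF vdc_ref_gt0) => /eqP.
have X0 : u Xi = 0.
  have := F0 Vdc; rewrite /error_field /error_input /error_output V0 I1 N0.
  move=> /eqP; rewrite mulf_eq0 invr_eq0 (gt_eqF Mdc_gt0) orbF => /eqP h.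
  have : Ki p * u Xi = 0 by lra.
  by move=> /eqP; rewrite mulf_eq0 (gt_eqF Ki_gt0) => /eqP.
by case.
Qed.

End ErrorSystem.

(** * Combinations of the identity and the quarter turn *)

Section PlaneMatrices.
Context {R : realType}.
Implicit Types (v : 'cV[R]_2) (a b c d : R).

Lemma ord2P (P : 'I_2 -> Prop) : P 0 -> P 1 -> forall i, P i.
Proof.
move=> P0 P1 [[|[|//]] i2].
- by rewrite (_ : Ordinal i2 = 0)//; exact: val_inj.
- by rewrite (_ : Ordinal i2 = 1)//; exact: val_inj.
Qed.

Lemma col2P (u v : 'cV[R]_2) : u = v <-> u 0 0 = v 0 0 /\ u 1 0 = v 1 0.
Proof.
split=> [->//|[h0 h1]]; apply/matrixP => i j; rewrite (ord1 j).
by move: i; apply: ord2P.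
Qed.

Lemma sum2E (F : 'I_2 -> R) : \sum_i F i = F 0 + F 1.
Proof.
rewrite !big_ord_recl big_ord0 addr0; congr (_ + F _).
exact: val_inj.
Qed.

Lemma rotation_scalingE a b :
  [/\ (a%:M + b *: J2 R) 0 0 = a, (a%:M + b *: J2 R) 0 1 = - b,
      (a%:M + b *: J2 R) 1 0 = b & (a%:M + b *: J2 R) 1 1 = a].
Proof. by split; rewrite !mxE /=; ring. Qed.

Lemma rotation_scaling_mul0 a b v : ((a%:M + b *: J2 R) *m v) 0 0 = a * v 0 0 - b * v 1 0.
Proof. by have [e00 e01 _ _] := rotation_scalingE a b; rewrite mxE sum2E e00 e01 mulNr. Qed.

Lemma rotation_scaling_mul1 a b v : ((a%:M + b *: J2 R) *m v) 1 0 = a * v 1 0 + b * v 0 0.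
Proof. by have [_ _ e10 e11] := rotation_scalingE a b; rewrite mxE sum2E e10 e11 addrC. Qed.

(** Multiplication of the complex numbers a + b i and c + d i. *)
Lemma rotation_scalingM a b c d :
  (a%:M + b *: J2 R) *m (c%:M + d *: J2 R) = (a * c - b * d)%:M + (a * d + b * c) *: J2 R.
Proof.
have [a00 a01 a10 a11] := rotation_scalingE a b.
have [c00 c01 c10 c11] := rotation_scalingE c d.
have [d00 d01 d10 d11] := rotation_scalingE (a * c - b * d) (a * d + b * c).
apply/matrixP; apply: ord2P; apply: ord2P; rewrite mxE sum2E ?a00 ?a01 ?a10 ?a11.
- by rewrite c00 c10 d00; ring.
- by rewrite c01 c11 d01; ring.
- by rewrite c00 c10 d10; ring.
- by rewrite c01 c11 d11; ring.
Qed.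

Lemma enorm_col2 v : enorm v ^+ 2 = v 0 0 ^+ 2 + v 1 0 ^+ 2.
Proof.
rewrite /enorm sqr_sqrtr; last by apply: sumr_ge0 => i _; exact: sqr_ge0.
by rewrite sum2E.
Qed.

Lemma enorm_ge0 n (v : 'cV[R]_n) : 0 <= enorm v.
Proof. exact: sqrtr_ge0. Qed.

Lemma enorm_rotation_scaling a b v :
  enorm ((a%:M + b *: J2 R) *m v) ^+ 2 = (a ^+ 2 + b ^+ 2) * enorm v ^+ 2.
Proof. by rewrite !enorm_col2 rotation_scaling_mul0 rotation_scaling_mul1; ring. Qed.

Lemma opnorm_rotation_scaling a b : opnorm (a%:M + b *: J2 R) ^+ 2 = a ^+ 2 + b ^+ 2.
Proof.
have ab0 : 0 <= a ^+ 2 + b ^+ 2 by rewrite addr_ge0 ?sqr_ge0.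
have unit v : enorm v = 1 -> enorm ((a%:M + b *: J2 R) *m v) = Num.sqrt (a ^+ 2 + b ^+ 2).
  move=> v1; apply/eqP; rewrite -(@eqrXn2 _ 2)// ?enorm_ge0 ?sqrtr_ge0//.
  by rewrite enorm_rotation_scaling v1 sqr_sqrtr// expr1n mulr1.
rewrite /opnorm (_ : [set _ | v in _] = [set Num.sqrt (a ^+ 2 + b ^+ 2)]).
  by rewrite sup1 sqr_sqrtr.
apply/seteqP; split => [_ [v v1 <-]|_ ->]; first exact: unit.
have e21 : enorm (e2 R) = 1.
  by apply/eqP; rewrite -(@eqrXn2 _ 2)// ?enorm_ge0// enorm_col2 !mxE/= expr0n expr1n add0r.
by exists (e2 R) => //; exact: unit.
Qed.

End PlaneMatrices.

(** * Coordinates of the state space *)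

Section VectorDerivatives.
Context {R : realType} {E F : normedModType R}.

(** The first hypothesis is the only consequence of linearity that a difference
    quotient needs. *)
Lemma is_derive_linear_comp (phi : E -> F) (x : R -> E) (t : R) :
  (forall k u v, phi (k *: (u - v)) = k *: (phi u - phi v)) -> continuous phi ->
  derivable x t 1 -> is_derive t 1 (fun s => phi (x s)) (phi ('D_1 x t)).
Proof.
move=> philin phic xd.
have h : phi (h^-1 *: ((x \o shift t) (h *: (1 : R)) - x t)) @[h --> 0^'] --> phi ('D_1 x t).
  exact: (cvg_comp _ phi xd (phic _)).
have E0 : (fun h : R => phi (h^-1 *: ((x \o shift t) (h *: (1 : R)) - x t)))
  = (fun h : R => h^-1 *: (((fun s => phi (x s)) \o shift t) (h *: (1 : R)) - phi (x t))).
  by apply/funext => h'; rewrite philin.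
rewrite E0 in h.
split; first by apply/cvg_ex; exists (phi ('D_1 x t)).
exact/cvg_lim.
Qed.

Lemma is_derive_pair (f : R -> E) (g : R -> F) (t : R) df dg :
  is_derive t 1 f df -> is_derive t 1 g dg ->
  is_derive t 1 (fun s => (f s, g s)) (df, dg).
Proof.
move=> [fd <-] [gd <-].
have h : (fun h : R => (h^-1 *: ((f \o shift t) (h *: (1 : R)) - f t),
            h^-1 *: ((g \o shift t) (h *: (1 : R)) - g t))) h @[h --> 0^']
   --> ('D_1 f t, 'D_1 g t) by exact: cvg_pair fd gd.
split; first by apply/cvg_ex; exists ('D_1 f t, 'D_1 g t).
exact/cvg_lim.
Qed.

End VectorDerivatives.

Lemma is_derive_scale_vector (R : realType) (E : normedModType R) (x : R -> R) (v : E) (t dx : R) :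
  is_derive t 1 x dx -> is_derive t 1 (fun s => x s *: v) (dx *: v).
Proof.
move=> [xd <-]; apply: (@is_derive_linear_comp R R^o E (fun k => k *: v)) => //.
- by move=> k a b; rewrite -scalerA scalerBl.
- by move=> k; apply: cvgZr_tmp; exact: cvg_id.
Qed.

Section Coordinates.
Context {R : realType}.
Implicit Types (u : coordinate -> R) (z : cl_state R).

Definition col2 (a b : R) : 'cV[R]_2 := a *: delta_mx 0 0 + b *: delta_mx 1 0.

Definition of_coords u : cl_state R :=
  (u Xi, u Vdc, col2 (u Id) (u Iq), col2 (u Vd) (u Vq), u Nu).

Definition coords z (c : coordinate) : R :=
  match c with
  | Xi => z.1.1.1.1 | Vdc => z.1.1.1.2
  | Id => z.1.1.2 0 0 | Iq => z.1.1.2 1 0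
  | Vd => z.1.2 0 0 | Vq => z.1.2 1 0
  | Nu => z.2
  end.

Lemma col2E (v : 'cV[R]_2) : col2 (v 0 0) (v 1 0) = v.
Proof. by apply/col2P; rewrite !mxE /= !mulr1 !mulr0 addr0 add0r. Qed.

Lemma coordsK z : of_coords (coords z) = z.
Proof. by case: z => [[[[xi v] i] w] nu]; rewrite /of_coords /= !col2E. Qed.

Lemma of_coordsK u c : coords (of_coords u) c = u c.
Proof. by case: c; rewrite //= !mxE /= !mulr1 !mulr0 ?addr0 ?add0r. Qed.

Lemma coordsB z z' c : coords (z - z') c = coords z c - coords z' c.
Proof. by case: c; rewrite //= !mxE. Qed.

Lemma coordsZ k z c : coords (k *: z) c = k * coords z c.
Proof. by case: c; rewrite //= !mxE. Qed.

Lemma coords_inj z z' : (forall c, coords z c = coords z' c) -> z = z'.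
Proof. by move=> h; rewrite -(coordsK z) -(coordsK z'); congr of_coords; apply/funext. Qed.

Lemma cvg_coords {T : Type} (F : set_system T) {FF : Filter F} (x : T -> cl_state R)
  (l : cl_state R) c : x t @[t --> F] --> l -> coords (x t) c @[t --> F] --> coords l c.
Proof.
move=> xl.
have x1 : (x t).1 @[t --> F] --> l.1 by apply: (cvg_comp _ _ xl); exact: cvg_fst.
have x2 : (x t).2 @[t --> F] --> l.2 by apply: (cvg_comp _ _ xl); exact: cvg_snd.
have x11 : (x t).1.1 @[t --> F] --> l.1.1 by apply: (cvg_comp _ _ x1); exact: cvg_fst.
have x12 : (x t).1.2 @[t --> F] --> l.1.2 by apply: (cvg_comp _ _ x1); exact: cvg_snd.
have x111 : (x t).1.1.1 @[t --> F] --> l.1.1.1 by apply: (cvg_comp _ _ x11); exact: cvg_fst.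
have x112 : (x t).1.1.2 @[t --> F] --> l.1.1.2 by apply: (cvg_comp _ _ x11); exact: cvg_snd.
have x3 : (x t).1.1.1.1 @[t --> F] --> l.1.1.1.1 by apply: (cvg_comp _ _ x111); exact: cvg_fst.
have x4 : (x t).1.1.1.2 @[t --> F] --> l.1.1.1.2 by apply: (cvg_comp _ _ x111); exact: cvg_snd.
have entry (y : T -> 'cV[R]_2) (m : 'cV[R]_2) i :
    y t @[t --> F] --> m -> y t i 0 @[t --> F] --> m i 0.
  by move=> ym; apply: (cvg_comp y (fun M : 'cV[R]_2 => M i 0) ym); exact: coord_continuous.
case: c.
- exact: x3.
- exact: x4.
- exact: (entry _ _ _ x112).
- exact: (entry _ _ _ x112).
- exact: (entry _ _ _ x12).
- exact: (entry _ _ _ x12).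
- exact: x2.
Qed.

Lemma cvg_of_coords {T : Type} (F : set_system T) {FF : Filter F} (x : T -> coordinate -> R)
  (l : coordinate -> R) : (forall c, x t c @[t --> F] --> l c) ->
  of_coords (x t) @[t --> F] --> of_coords l.
Proof.
move=> xl.
have xcol c c' : col2 (x t c) (x t c') @[t --> F] --> col2 (l c) (l c').
  by apply: cvgD; apply: cvgZr_tmp; exact: xl.
exact: (cvg_pair (cvg_pair (cvg_pair (cvg_pair (xl Xi) (xl Vdc))
  (xcol Id Iq)) (xcol Vd Vq)) (xl Nu)).
Qed.

Lemma is_derive_coords (x : R -> cl_state R) (t : R) c :
  derivable x t 1 -> is_derive t 1 (fun s => coords (x s) c) (coords ('D_1 x t) c).
Proof.
apply: (@is_derive_linear_comp R _ _ (fun z : cl_state R => coords z c : R^o)).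
- by move=> k z z'; rewrite coordsZ coordsB.
- move=> z; exact: (@cvg_coords _ (nbhs z) _ id).
Qed.

Lemma is_derive_of_coords (x : R -> coordinate -> R) (t : R) u :
  (forall c, is_derive t 1 (x^~ c) (u c)) ->
  is_derive t 1 (fun s => of_coords (x s)) (of_coords u).
Proof.
move=> xD.
have xcol c c' : is_derive t 1 (fun s => col2 (x s c) (x s c')) (col2 (u c) (u c')).
  by apply: is_deriveD; exact: is_derive_scale_vector.
exact: (is_derive_pair _ _ _ _ _ (is_derive_pair _ _ _ _ _ (is_derive_pair _ _ _ _ _
  (is_derive_pair _ _ _ _ _ (xD Xi) (xD Vdc)) (xcol Id Iq)) (xcol Vd Vq)) (xD Nu)).
Qed.

Lemma col2_norm_lt (v : 'cV[R]_2) (e : R) : 0 < e -> `|v 0 0| < e -> `|v 1 0| < e -> `|v| < e.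
Proof.
move=> e0 v0 v1; rewrite /Num.norm /= mx_normrE.
apply: bigmax_lt => // -[i j] _ /=; rewrite (ord1 j).
by move: i; apply: ord2P.
Qed.

Lemma col2_norm_ge (v : 'cV[R]_2) i : `|v i 0| <= `|v|.
Proof.
rewrite [leRHS]/Num.norm /= mx_normrE.
exact: (le_bigmax _ (fun ij : 'I_2 * 'I_1 => `|v ij.1 ij.2|) (i, 0)).
Qed.

Lemma norm_lt_coords z (e : R) : (forall c, `|coords z c| < e) -> `|z| < e.
Proof.
move=> h; have e0 : 0 < e := le_lt_trans (normr_ge0 _) (h Nu).
rewrite !prod_normE /= !gt_max.
rewrite (h Xi) (h Vdc) (h Nu) /= andbT.
by rewrite (col2_norm_lt _ _ e0 (h Id) (h Iq)) (col2_norm_lt _ _ e0 (h Vd) (h Vq)).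
Qed.

Lemma coords_le_norm z c : `|coords z c| <= `|z|.
Proof.
rewrite !prod_normE /=; case: c => /=; rewrite !le_max ?lexx ?orbT//.
- by rewrite (col2_norm_ge z.1.1.2 0) !orbT.
- by rewrite (col2_norm_ge z.1.1.2 1) !orbT.
- by rewrite (col2_norm_ge z.1.2 0) !orbT.
- by rewrite (col2_norm_ge z.1.2 1) !orbT.
Qed.

End Coordinates.

(** * The equilibrium *)

Section Equilibrium.
Context {R : realType} (p : params R).
Implicit Types (u : coordinate -> R) (x : inv_state R).

Lemma inverterE (mu : R) (x dx : inv_state R) :
  inverter p mu x dx <->
  let u := coords (x, 0) in let du := coords (dx, 0) in
  [/\ du Xi = u Vdc - vdc_ref p,
      (Cdc p + Kd p) * du Vdc = - (Gdc p * u Vdc) + idc_ref p - Kp p * (u Vdc - vdc_ref p)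
        - Ki p * u Xi - mu / 2 * u Iq,
      Lf p * du Id = - (Rf p * u Id - u Vdc * eta_ref p * Lf p * u Iq) - u Vd /\
      Lf p * du Iq = - (Rf p * u Iq + u Vdc * eta_ref p * Lf p * u Id)
        + mu / 2 * u Vdc - u Vq &
      Cf p * du Vd = - (Gf p * u Vd - u Vdc * eta_ref p * Cf p * u Vq) - sl p 0 0 + u Id /\
      Cf p * du Vq = - (Gf p * u Vq + u Vdc * eta_ref p * Cf p * u Vd) - sl p 1 0 + u Iq].
Proof.
case: x => [[[xi v] i] w]; case: dx => [[[dxi dv] di] dw] /=.
have addE (a b : 'cV[R]_2) k : (a + b) k 0 = a k 0 + b k 0 by rewrite mxE.
have oppE (a : 'cV[R]_2) k : (- a) k 0 = - a k 0 by rewrite mxE.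
have sclE (c : R) (a : 'cV[R]_2) k : (c *: a) k 0 = c * a k 0 by rewrite mxE.
have e20 : e2 R 0 0 = 0 by rewrite mxE.
have e21 : e2 R 1 0 = 1 by rewrite mxE.
have simpE := (addE, oppE, sclE, @rotation_scaling_mul0 R, @rotation_scaling_mul1 R, e20, e21).
by rewrite !(propext (col2P _ _)) !simpE /qcomp (mulr0 (_ * v)) mulr1 addr0.
Qed.

Lemma inverter_equilibriumE (mu : R) (x : inv_state R) :
  equilibrium (inverter p mu) x <->
  let u := coords (x, 0) in
  [/\ u Vdc = vdc_ref p,
      0 = - (Gdc p * u Vdc) + idc_ref p - Kp p * (u Vdc - vdc_ref p)
        - Ki p * u Xi - mu / 2 * u Iq,
      0 = - (Rf p * u Id - u Vdc * eta_ref p * Lf p * u Iq) - u Vd /\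
      0 = - (Rf p * u Iq + u Vdc * eta_ref p * Lf p * u Id) + mu / 2 * u Vdc - u Vq &
      0 = - (Gf p * u Vd - u Vdc * eta_ref p * Cf p * u Vq) - sl p 0 0 + u Id /\
      0 = - (Gf p * u Vq + u Vdc * eta_ref p * Cf p * u Vd) - sl p 1 0 + u Iq].
Proof.
have zero c : coords (0 : inv_state R, 0) c = 0 by case: c; rewrite //= mxE.
rewrite /equilibrium inverterE; cbv zeta; rewrite !zero !mulr0.
by split=> -[h1 h2 h3 h4]; split => //;
  [apply/esym/eqP; rewrite eq_sym -subr_eq0 -h1|rewrite h1 subrr].
Qed.

Context (L_gt0 : 0 < Lf p) (R_gt0 : 0 < Rf p) (C_gt0 : 0 < Cf p) (G_gt0 : 0 < Gf p)
  (Ki_gt0 : 0 < Ki p) (omega0_gt0 : 0 < omega0 p) (vdc_ref_gt0 : 0 < vdc_ref p)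
  (r_ref_gt0 : 0 < r_ref p) (psi_gt0 : 0 < psi p).

(** Real and imaginary parts of the complex number z y + 1, where z and y are the
    impedance and the admittance. *)
Let al := Rf p * Gf p - omega0 p * Lf p * (omega0 p * Cf p) + 1.
Let be := Rf p * (omega0 p * Cf p) + omega0 p * Lf p * Gf p.

Lemma ZY1E : Zmx p *m Ymx p + 1%:M = al%:M + be *: J2 R.
Proof. by rewrite /Zmx /Ymx rotation_scalingM /al [(_ + 1)%:M]raddfD /= addrAC. Qed.

(** The imaginary part is positive, so Z Y + I is invertible. *)
Lemma albe_gt0 : 0 < al ^+ 2 + be ^+ 2.
Proof.
rewrite ltr_wpDl ?sqr_ge0// exprn_gt0// /be addr_gt0// !mulr_gt0//.
Qed.

(** The quadratic equation of which mu_+ is the larger root. *)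
Lemma mu_plus_root :
  (mu_plus p * vdc_ref p / 2) ^+ 2 - mu_plus p * vdc_ref p * qcomp (Zmx p *m sl p) = psi p.
Proof.
have v0 : vdc_ref p != 0 by rewrite gt_eqF.
set q := qcomp _.
have := @sqr_sqrtr _ ((b_coef p / 2) ^+ 2 + 4 * psi p / vdc_ref p ^+ 2).
rewrite addr_ge0 ?sqr_ge0 ?divr_ge0 ?sqr_ge0 ?mulr_ge0 ?(ltW psi_gt0)// => /(_ isT).
have -> : Num.sqrt ((b_coef p / 2) ^+ 2 + 4 * psi p / vdc_ref p ^+ 2) = mu_plus p - b_coef p / 2.
  by rewrite /mu_plus addrAC subrr add0r.
rewrite /b_coef -/q => h.
have {}h : psi p = vdc_ref p ^+ 2 / 4 *
   ((mu_plus p - 4 / vdc_ref p * q / 2) ^+ 2 - (4 / vdc_ref p * q / 2) ^+ 2).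
  by rewrite h; field.
by rewrite h; field.
Qed.

(** Eliminating the current from the filter equations leaves
    (Z Y + I) v = (mu / 2) v_ref e2 - Z s, which is solved by complex division; the
    integral action xi then balances the dc equation. *)
Lemma star_exists : exists x, equilibrium (inverter p (mu_plus p)) x.
Proof.
pose m := mu_plus p.
pose h0 := - (Zmx p *m sl p) 0 0; pose h1 := m / 2 * vdc_ref p - (Zmx p *m sl p) 1 0.
pose D := al ^+ 2 + be ^+ 2.
pose v0 := (al * h0 + be * h1) / D; pose v1 := (al * h1 - be * h0) / D.
pose i0 := Gf p * v0 - omega0 p * Cf p * v1 + sl p 0 0.
pose i1 := Gf p * v1 + omega0 p * Cf p * v0 + sl p 1 0.
pose xi := (- (Gdc p * vdc_ref p) + idc_ref p - m / 2 * i1) / Ki p.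
exists (xi, vdc_ref p, col2 i0 i1, col2 v0 v1).
have D0 : D != 0 by rewrite gt_eqF// albe_gt0.
have a0 : al * v0 - be * v1 = h0 by rewrite /v0 /v1 /D; field.
have a1 : al * v1 + be * v0 = h1 by rewrite /v0 /v1 /D; field.
have eta1 : vdc_ref p * eta_ref p = omega0 p by rewrite /eta_ref mulrC divfK ?gt_eqF.
apply/inverter_equilibriumE; rewrite /= !mxE /= !mulr0 !mulr1 !addr0 !add0r subrr eta1 -/m.
move: a0 a1; rewrite /h0 /h1 /Zmx rotation_scaling_mul0 rotation_scaling_mul1 /al /be => a0 a1.
clearbody v0 v1; split => //.
- by rewrite /xi /m; field; rewrite gt_eqF.
- by split; rewrite /i0 /i1; lra.
- by split; rewrite /i0 /i1; ring.
Qed.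

Lemma star_equilibrium : equilibrium (inverter p (mu_plus p)) (star p).
Proof. exact: getPex star_exists. Qed.

Lemma vdc_star_ref : vdc_star p = vdc_ref p.
Proof.
by have /inverter_equilibriumE [] := star_equilibrium.
Qed.

(** Taking norms in (Z Y + I) v = (mu / 2) v_ref e2 - Z s, the squared norm of the
    right-hand side is psi + |Z s|^2 by the equation of mu_+, that is,
    r_ref^2 |Z Y + I|^2. *)
Lemma enorm_vdq_star : enorm (vdq_star p) = r_ref p.
Proof.
have /inverter_equilibriumE /= [_ _] := star_equilibrium.
rewrite -/(vdc_star p) -/(idq_star p) -/(vdq_star p) vdc_star_ref.
have -> : vdc_ref p * eta_ref p = omega0 p by rewrite /eta_ref mulrC divfK ?gt_eqF.
move: (vdq_star p) (idq_star p) => v i [] e0 e1 [] e2 e3.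
have i0 : i 0 0 = Gf p * v 0 0 - omega0 p * Cf p * v 1 0 + sl p 0 0 by lra.
have i1 : i 1 0 = Gf p * v 1 0 + omega0 p * Cf p * v 0 0 + sl p 1 0 by lra.
have a0 : al * v 0 0 - be * v 1 0 = - (Zmx p *m sl p) 0 0.
  by rewrite /Zmx rotation_scaling_mul0; rewrite i0 i1 in e0; rewrite /al /be; lra.
have a1 : al * v 1 0 + be * v 0 0 = mu_plus p * vdc_ref p / 2 - (Zmx p *m sl p) 1 0.
  by rewrite /Zmx rotation_scaling_mul1; rewrite i0 i1 in e1; rewrite /al /be; lra.
have key : (al ^+ 2 + be ^+ 2) * enorm v ^+ 2 = (al ^+ 2 + be ^+ 2) * r_ref p ^+ 2.
  transitivity ((al * v 0 0 - be * v 1 0) ^+ 2 + (al * v 1 0 + be * v 0 0) ^+ 2).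
    by rewrite enorm_col2; ring.
  have := mu_plus_root; rewrite /psi ZY1E opnorm_rotation_scaling enorm_col2 a0 a1 /qcomp.
  move=> h; lra.
apply/eqP; rewrite -(@eqrXn2 _ 2)// ?enorm_ge0 ?(ltW r_ref_gt0)//; apply/eqP.
by move/mulfI : key; apply; rewrite gt_eqF// albe_gt0.
Qed.

End Equilibrium.

(** * Stability of the closed loop *)

Section ClosedLoop.
Context {R : realType} (p : params R)
  (L_gt0 : 0 < Lf p) (C_gt0 : 0 < Cf p) (M_gt0 : 0 < Cdc p + Kd p)
  (eq_star : equilibrium (inverter p (mu_plus p)) (star p)).

Definition star_field : (coordinate -> R) -> coordinate -> R :=
  error_field p (mu_plus p) (idq_star p 0 0) (idq_star p 1 0)
    (vdq_star p 0 0) (vdq_star p 1 0).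

Definition error (z : cl_state R) (c : coordinate) : R :=
  coords z c - coords (star p, 0) c.

(** Subtracting the equilibrium equations of the starred state from those of the
    closed loop, and dividing by the leading coefficients. *)
Lemma closed_loop_error (z dz : cl_state R) :
  closed_loop p z dz <-> forall c, coords dz c = star_field (error z) c.
Proof.
move: eq_star => /inverter_equilibriumE /=.
rewrite -/(vdc_star p) -/(idq_star p) -/(vdq_star p).
move=> [sV sX [sI0 sI1] [sU0 sU1]].
have L0 := lt0r_neq0 L_gt0; have C0 := lt0r_neq0 C_gt0; have M0 := lt0r_neq0 M_gt0.
have cancelE (a b c : R) : a != 0 -> (a * b = c) = (b = c / a).
  move=> a0; apply/propext; split=> [<-|->]; first by rewrite mulrC mulKf.
  by rewrite mulrC divfK.
case: z => x nu; case: dz => dx dnu.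
rewrite /closed_loop; set mt := - _ - _.
have mtE : mt = error_input p (idq_star p 1 0) (error (x, nu)).
  rewrite /mt /error_input /error_output /error /y_out /qcomp.
  case: x {mt} => [[[xi v] i] w] /=; rewrite -/(vdc_star p) -/(idq_star p) sV; ring.
have yE : y_out p x = error_output p (idq_star p 1 0) (error (x, nu)).
  rewrite /error_output /error /y_out /qcomp.
  case: x {mt mtE} => [[[xi v] i] w] /=; rewrite -/(vdc_star p) -/(idq_star p) sV; ring.
rewrite inverterE; cbv zeta.
set u := coords (x, 0); set du := coords (dx, 0).
rewrite !cancelE//.
have uE c : c <> Nu -> u c = error (x, nu) c + coords (star p, 0) c.
  by rewrite /error subrK; case: c.
have duE c : c <> Nu -> du c = coords (dx, dnu) c by case: c.
pose e := error (x, nu).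
rewrite !uE// !duE// -/e /= -/(vdc_star p) -/(idq_star p) -/(vdq_star p) in mtE yE *.
rewrite mtE yE.
pose F := star_field e.
have F1 : e Vdc + vdc_star p - vdc_ref p = F Xi by rewrite /F /star_field /= sV; ring.
set r2 := _ / (Cdc p + Kd p).
have F2 : r2 = F Vdc.
  rewrite /r2 /F /star_field /=; congr (_ / _); rewrite sV in sX *; lra.
set r3 := _ / Lf p; set r4 := _ / Lf p; set r5 := _ / Cf p; set r6 := _ / Cf p.
have F3 : r3 = F Id.
  rewrite /r3 /F /star_field /=; congr (_ / _); rewrite sV in sI0 *; lra.
have F4 : r4 = F Iq.
  rewrite /r4 /F /star_field /=; congr (_ / _); rewrite sV in sI1 *; lra.
have F5 : r5 = F Vd.
  rewrite /r5 /F /star_field /=; congr (_ / _); rewrite sV in sU0 *; lra.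
have F6 : r6 = F Vq.
  rewrite /r6 /F /star_field /=; congr (_ / _); rewrite sV in sU1 *; lra.
rewrite F1 F2 F3 F4 F5 F6 -/F.
split=> [[[h1 h2 [h3 h4] [h5 h6]] h7]|h]; first by case.
by split; [split; [exact: (h Xi)|exact: (h Vdc)|split; [exact: (h Id)|exact: (h Iq)]
  |split; [exact: (h Vd)|exact: (h Vq)]]|exact: (h Nu)].
Qed.

Lemma error_solution_of_solution (z : R -> cl_state R) :
  solution (closed_loop p) z ->
  error_solution p (mu_plus p) (idq_star p 0 0) (idq_star p 1 0)
    (vdq_star p 0 0) (vdq_star p 1 0) (fun t => error (z t)).
Proof.
move=> [z0 zD]; split=> [c|t t0 c].
  by apply: cvgB; [exact: cvg_coords|exact: cvg_cst].
have [zd /closed_loop_error zF] := zD t t0.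
have := is_deriveB (is_derive_coords z t c zd) (is_derive_cst (coords (star p, 0) c) t (1 : R)).
by rewrite subr0 zF.
Qed.

Lemma solution_of_error_solution (x : R -> coordinate -> R) :
  error_solution p (mu_plus p) (idq_star p 0 0) (idq_star p 1 0)
    (vdq_star p 0 0) (vdq_star p 1 0) x ->
  solution (closed_loop p) (fun t => of_coords (fun c => x t c + coords (star p, 0) c)).
Proof.
move=> [x0 xD]; split.
  by apply: cvg_of_coords => c; apply: cvgD; [exact: x0|exact: cvg_cst].
move=> t t0.
have zD : is_derive t 1 (fun s => of_coords (fun c => x s c + coords (star p, 0) c))
    (of_coords (star_field (x t))).
  apply: is_derive_of_coords => c.
  have := is_deriveD (xD t t0 c) (is_derive_cst (coords (star p, 0) c) t (1 : R)).
  by rewrite addr0.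
have [zd zE] := zD; split => //; rewrite zE.
apply/closed_loop_error => c; rewrite of_coordsK.
congr (star_field _ c); apply/funext => c'.
by rewrite /error of_coordsK addrK.
Qed.

End ClosedLoop.

Theorem proposition9 (R : realType) (p : params R)
  (Cdc_gt0 : 0 < Cdc p) (Gdc_gt0 : 0 < Gdc p)
  (L_gt0 : 0 < Lf p) (R_gt0 : 0 < Rf p) (C_gt0 : 0 < Cf p) (G_gt0 : 0 < Gf p)
  (Kp_gt0 : 0 < Kp p) (Ki_gt0 : 0 < Ki p) (Kd_gt0 : 0 < Kd p)
  (idc_ref_gt0 : 0 < idc_ref p)
  (omega0_gt0 : 0 < omega0 p) (vdc_ref_gt0 : 0 < vdc_ref p)
  (r_ref_gt0 : 0 < r_ref p)
  (kappa_p_gt0 : 0 < kappa_p p) (kappa_i_gt0 : 0 < kappa_i p)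
  (psi_gt0 : 0 < psi p)
  (stab : Cf p ^+ 2 * enorm (vdq_star p) ^+ 2 / (4 * Gf p)
        + Lf p ^+ 2 * enorm (idq_star p) ^+ 2 / (4 * Rf p)
        < Gdc p / eta_ref p ^+ 2) :
  let ze : cl_state R := (star p, 0) in
  [/\ (forall z : cl_state R, equilibrium (closed_loop p) z <-> z = ze),
      vdc_star p = vdc_ref p,
      enorm (vdq_star p) = r_ref p
    & globally_asymptotically_stable (closed_loop p) ze].
Proof.
move=> ze.
have M_gt0 : 0 < Cdc p + Kd p by exact: addr_gt0.
have eq_star : equilibrium (inverter p (mu_plus p)) (star p) by exact: star_equilibrium.
have adm : admissible p (idq_star p 0 0) (idq_star p 1 0) (vdq_star p 0 0) (vdq_star p 1 0).
  by split; rewrite -?enorm_col2.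
have cl_error := closed_loop_error p L_gt0 C_gt0 M_gt0 eq_star.
have to_error := error_solution_of_solution p L_gt0 C_gt0 M_gt0 eq_star.
split; [| exact: vdc_star_ref | exact: enorm_vdq_star | split].
- move=> z; rewrite /equilibrium cl_error.
  have zero c : coords (0 : cl_state R) c = 0 by case: c; rewrite //= mxE.
  split=> [h|-> c].
    apply: coords_inj => c; apply/eqP; rewrite -subr_eq0; apply/eqP.
    change (error p z c = 0); apply: (error_field_eq0 _ (mu_plus p) _ _ _ _ adm) => c'.
    by rewrite -[LHS]h zero.
  rewrite zero /star_field.
  have -> : error p ze = (fun=> 0) by apply/funext => c'; rewrite /error subrr.
  by case: c; rewrite /error_field /error_input /error_output /=; ring.
- move=> z0.
  have [x [x0 xs]] := error_system_complete _ (mu_plus p) _ _ _ _ adm (error p z0).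
  exists (fun t => of_coords (fun c => x t c + coords ze c)).
    exact: (solution_of_error_solution p L_gt0 C_gt0 M_gt0 eq_star).
  by apply: coords_inj => c; rewrite of_coordsK x0 /error subrK.
- move=> eps eps0.
  have [K K0 hK] := sqr_coordinate_le _ _ _ _ _ adm.
  have [K' K'0 hK'] := energy_le_sqr _ _ _ _ _ adm.
  (* 27 = 5^2 + 1 + 1: five dissipated coordinates summed before squaring, and the
     two integrator states. *)
  pose s := 27 * (K * K').
  have s0 : 0 < s by rewrite !mulr_gt0.
  pose del := eps / (1 + s).
  have del0 : 0 < del by rewrite divr_gt0// addr_gt0.
  exists del => // z zs z0 t t0.
  apply: norm_lt_coords => c; rewrite coordsB -/(error p (z t) c).
  rewrite -ltr_sqr ?nnegrE// ?(ltW eps0)// real_normK ?num_real//.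
  apply: le_lt_trans (hK _ _) _.
  have mono := energy_solution_nonincreasing _ _ _ _ _ _ adm _ t (to_error _ zs) t0.
  apply: (@le_lt_trans _ _ (K * (K' * (27 * del ^+ 2)))).
    rewrite ler_pM2l//; apply: le_trans mono _; apply: le_trans (hK' _) _.
    rewrite ler_pM2l//.
    have small c' : `|error p (z 0) c'| <= del.
      by rewrite /error -coordsB; apply: le_trans (ltW z0); exact: coords_le_norm.
    have sq (a b : R) : 0 <= a -> a <= b -> a ^+ 2 <= b ^+ 2.
      by move=> a0 ab; rewrite ler_sqr ?nnegrE// (le_trans a0).
    have h1 : damped (error p (z 0)) ^+ 2 <= (5 * del) ^+ 2.
      apply: sq; first exact: damped_ge0.
      have := small Vdc; have := small Id; have := small Iq; have := small Vd.
      have := small Vq; rewrite /damped; lra.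
    have h2 := sq _ _ (normr_ge0 _) (small Nu).
    have h3 := sq _ _ (normr_ge0 _) (small Xi).
    rewrite exprMn in h1; lra.
  have -> : K * (K' * (27 * del ^+ 2)) = eps ^+ 2 * (s / (1 + s) ^+ 2).
    by rewrite /del /s; field; rewrite -/s gt_eqF// addr_gt0.
  rewrite gtr_pMr ?exprn_gt0// ltr_pdivrMr ?exprn_gt0 ?addr_gt0// mul1r.
  by have := sqr_ge0 s; rewrite sqrrD; lra.
- move=> z zs.
  have zc c : coords (z t) c @[t --> +oo] --> coords ze c.
    have := error_solution_to_zero _ _ _ _ _ _ adm _ c (to_error _ zs).
    by move=> /cvg_sub0; apply; exact: cvg_cst.
  have zE : (fun t => of_coords [eta coords (z t)]) = z by apply/funext => t; exact: coordsK.
  have := cvg_of_coords _ _ _ zc; rewrite coordsK zE; apply.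
Qed.
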